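(* Consider online bin covering with advice. (i) There is an online algorithm with advice that, on every input sequence $\sigma$ of length $n$, produces an optimal covering (covers exactly $\mathrm{OPT}(\sigma)$ bins) while reading $O(n\log \mathrm{OPT}(\sigma))$ advice bits; conversely, restricting to input sequences $\sigma$ of length $n$ with $2\,\mathrm{OPT}(\sigma)\le (1-\epsilon)n$ for some fixed $\epsilon>0$, any online algorithm with advice that produces an optimal covering on all such sequences must read $\Omega(n\log \mathrm{OPT}(\sigma))$ advice bits. Thus advice of size $\Theta(n\log \mathrm{OPT}(\sigma))$ is required and sufficient to achieve an optimal solution under this assumption. (ii) When the input consists of $n$ items whose sizes are taken from a set of $m\in o(n)$ distinct item sizes known in advance to the algorithm, advice of size $\Theta(m\log n)$ is required and sufficient to achieve an optimal solution.
   Context: Bin covering: the input is a sequence of items with sizes in $(0,1]$; each item must be placed into a bin, and a bin is covered if the total size of items in it is at least $1$; the goal is to maximize the number of covered bins. In the online setting items arrive one by one and each must be irrevocably placed in a bin before the next is revealed. In the advice-on-tape model, an all-knowing oracle writes an advice string on a tape before processing starts; the algorithm knows the meaning of the advice and its decision for the $i$-th item may depend on the advice and on the first $i$ items. The advice complexity is the number of advice bits the algorithm reads. $\mathrm{OPT}(\sigma)$ denotes the maximum number of bins that can be covered with the items of $\sigma$. An algorithm is optimal if it covers $\mathrm{OPT}(\sigma)$ bins on every input $\sigma$ (with suitable advice).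
   Formalization: In (ii) the lower bound is proved only when, for large n, m ≥ 2 and m ≤ n^(1-δ) for a fixed δ>0 (it fails for m=1 and m=n/log n), for some set of m sizes; in (i) the upper bound is O(n log OPT + 1), as zero bits do not suffice at OPT=1. *)

(* Defs.v *)
From HB Require Import structures.
From mathcomp Require Import all_boot all_order all_algebra.
From mathcomp Require Import all_classical all_reals all_analysis.

Set Implicit Arguments.
Unset Strict Implicit.
Unset Printing Implicit Defensive.

Import Order.TTheory GRing.Theory Num.Theory.
Import numFieldNormedType.Exports.

Local Open Scope ring_scope.

Definition item_size (R : realType) (x : R) : bool := 0 < x <= 1.

(* An assignment of a sequence of items to bins is the sequence of the labels
   (natural numbers) of the bins in which the successive items are placed. *)
Definition bin_load (R : realType) (s : seq R) (p : seq nat) (b : nat) : R :=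
  \sum_(xb <- zip s p | xb.2 == b) xb.1.

Definition covered_bins (R : realType) (s : seq R) (p : seq nat) : nat :=
  count (fun b => 1 <= bin_load s p b) (undup p).

(* At most [size s] bins are nonempty, so the labels below [size s] suffice. *)
Definition OPT (R : realType) (s : seq R) : nat :=
  \max_(p : (size s).-tuple 'I_(size s)) covered_bins s (map val p).

(* [A t w] is the next action of the algorithm when [t] lists the items revealed
   so far, the last of which is not placed yet, and [w] lists the advice bits
   read so far: [None] reads the next bit of the tape, [Some b] irrevocably
   places the last item of [t] in bin [b]. Earlier placements are determined
   by [t] and [w], so they need not be arguments. *)
Definition online_alg (R : realType) := seq R -> seq bool -> option nat.

(* The oracle knows the whole input and fills an infinite tape, so the algorithm
   has to infer from the bits themselves how many of them to read. *)
Definition oracle (R : realType) := seq R -> nat -> bool.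

(* [run A tape s i r p]: started on input [s], the algorithm reaches the
   configuration where the first [i] items have been placed as recorded in [p]
   and exactly the first [r] bits of the tape have been read. *)
Inductive run (R : realType) (A : online_alg R) (tape : nat -> bool)
    (s : seq R) : nat -> nat -> seq nat -> Prop :=
| run_start : run A tape s 0 0 [::]
| run_read i r p :
    run A tape s i r p -> (i < size s)%N ->
    A (take i.+1 s) (mkseq tape r) = None ->
    run A tape s i r.+1 p
| run_place i r p b :
    run A tape s i r p -> (i < size s)%N ->
    A (take i.+1 s) (mkseq tape r) = Some b ->
    run A tape s i.+1 r (rcons p b).

(* With the advice of [O], [A] processes the whole of [s], produces an optimal
   covering and reads exactly [r] advice bits ([r] is unique, as runs on a given
   tape are deterministic). *)
Definition optimal_reading (R : realType) (A : online_alg R) (O : oracle R)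
    (s : seq R) (r : nat) : Prop :=
  exists2 p : seq nat,
    run A (O s) s (size s) r p & covered_bins s p = OPT s.

Definition optimal_on (R : realType) (A : online_alg R) (O : oracle R)
    (F : seq R -> Prop) : Prop :=
  forall s : seq R, F s -> exists r : nat, optimal_reading A O s r.

Definition sparse_input (R : realType) (eps : R) (n : nat) (s : seq R) : Prop :=
  [/\ all (@item_size R) s, size s = n & 2 * (OPT s)%:R <= (1 - eps) * n%:R].

Definition size_set (R : realType) (S : seq R) : Prop :=
  uniq S /\ all (@item_size R) S.

(* Main.v *)
(** Upper bounds: the oracle writes down a self-delimiting code of all the
    numbers the algorithm needs, and the algorithm reads it before placing the
    first item. These numbers are the labels of an optimal packing with labels
    below [max(1, OPT)], or the multiplicities of the item sizes; the latter
    determine the multiset of the items, so that the j-th item of size x can be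
    placed like the j-th item of size x in a fixed optimal packing.

    Lower bounds: if the inputs of a finite family are such that any two of them
    share a prefix whose packing cannot be completed optimally for both, then
    distinct inputs need distinct advice, hence some input needs at least log2 of
    the size of the family. In the families used for (i) and for (ii) with
    [m >= 4], a fixed list of small items comes first; a partition of it is then
    imposed by one complement [1 - y] for each part, [y] being the sum of the
    part. For (i) the small items are powers of two times a constant; for (ii)
    there are equally many items of about m/3 small sizes, and the parts are
    singletons and pairs of equal items. For [m <= 3] the inputs consist of items
    [1/3] followed by items [2/3]. *)

Require Import Defs.
From HB Require Import structures.
From mathcomp Require Import all_boot all_order all_algebra.
From mathcomp Require Import all_classical all_reals all_analysis.
From mathcomp Require Import zify lra.

Set Implicit Arguments.
Unset Strict Implicit.
Unset Printing Implicit Defensive.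

Import Order.TTheory GRing.Theory Num.Theory.
Import numFieldNormedType.Exports.

Local Open Scope classical_set_scope.
Local Open Scope ring_scope.

(** * Bin loads, coverings and relabelling of bins *)

Lemma bin_load_cat (R : realType) (s1 s2 : seq R) p1 p2 b :
  size p1 = size s1 ->
  bin_load (s1 ++ s2) (p1 ++ p2) b = bin_load s1 p1 b + bin_load s2 p2 b.
Proof. by move=> e; rewrite /bin_load zip_cat // big_cat. Qed.

Lemma bin_load_ge0 (R : realType) (s : seq R) p b :
  (forall x, x \in s -> 0 <= x) -> 0 <= bin_load s p b.
Proof.
move=> s_ge0; rewrite /bin_load big_seq_cond sumr_ge0 // => -[x c] /andP[xc _].
by apply: s_ge0; move/(map_f fst): xc; clear; elim: s p => [|y s IH] [|d p] //=;
  rewrite !inE => /orP[->//|/IH->]; rewrite orbT.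
Qed.

Lemma bin_load_notin (R : realType) (s : seq R) p b :
  b \notin p -> bin_load s p b = 0.
Proof.
rewrite /bin_load; elim: s p => [|y s IH] [|d p] /=; rewrite ?big_nil //.
by rewrite inE negb_or eq_sym big_cons /= => /andP[/negbTE-> /IH].
Qed.

Lemma bin_load_cons (R : realType) (x : R) s c p b :
  bin_load (x :: s) (c :: p) b = (if c == b then x else 0) + bin_load s p b.
Proof. by rewrite /bin_load /= big_cons /=; case: ifP; rewrite ?add0r. Qed.

Lemma sum_bin_load (R : realType) (s : seq R) p bs :
  size p = size s -> uniq bs ->
  \sum_(b <- bs) bin_load s p b = \sum_(xb <- zip s p | xb.2 \in bs) xb.1.
Proof.
elim: s p => [|x s IH] [|c p] //= => [_ _|[e] ubs].
  by rewrite big_nil big1 // => b _; rewrite /bin_load big_nil.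
under eq_bigr do rewrite bin_load_cons.
rewrite big_split /= IH // big_cons /=.
case: ifP => cbs; last first.
  rewrite big1_seq ?add0r // => b /andP[_ bbs]; case: eqP => // e'.
  by rewrite e' bbs in cbs.
congr (_ + _); rewrite (bigD1_seq c) //= eqxx big1 ?addr0 // => b.
by rewrite eq_sym => /negbTE->.
Qed.

Lemma sum_bin_load_all (R : realType) (s : seq R) p bs :
  size p = size s -> uniq bs -> {subset p <= bs} ->
  \sum_(b <- bs) bin_load s p b = \sum_(x <- s) x.
Proof.
move=> e ubs pbs; rewrite sum_bin_load //.
elim: s p e pbs => [|x s IH] [|c p] //= => [_ _|[e] pbs]; first by rewrite !big_nil.
rewrite !big_cons /= pbs ?mem_head // IH // => b bp.
by apply: pbs; rewrite inE bp orbT.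
Qed.

Lemma sum_bin_load_le (R : realType) (s : seq R) p bs :
  size p = size s -> uniq bs -> (forall x, x \in s -> 0 <= x) ->
  \sum_(b <- bs) bin_load s p b <= \sum_(x <- s) x.
Proof.
move=> e ubs s_ge0.
(* Adding to [bs] the labels of [p] that it misses turns the inequality into an exact count of the
   total size. *)
have ubs' : uniq (bs ++ [seq b <- undup p | b \notin bs]).
  rewrite cat_uniq ubs filter_uniq ?undup_uniq // andbT -all_predC.
  by apply/allP => b /=; rewrite mem_filter => /andP[].
rewrite -(sum_bin_load_all e ubs') => [|b bp].
  by rewrite big_cat lerDl sumr_ge0 // => b _; apply: bin_load_ge0.
by rewrite mem_cat mem_filter mem_undup bp andbT orbN.
Qed.

Lemma covered_bins_ge (R : realType) (s : seq R) p bs :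
  uniq bs -> (forall b, b \in bs -> 1 <= bin_load s p b) ->
  (size bs <= covered_bins s p)%N.
Proof.
move=> ubs cov; rewrite /covered_bins -size_filter uniq_leq_size // => b bbs.
rewrite mem_filter cov //= mem_undup; apply/negP => /negP /bin_load_notin e.
by move: (cov _ bbs); rewrite e; lra.
Qed.

Lemma covered_bins_le_sum (R : realType) (s : seq R) p :
  size p = size s -> (forall x, x \in s -> 0 <= x) ->
  (covered_bins s p)%:R <= \sum_(x <- s) x.
Proof.
move=> e s_ge0; rewrite /covered_bins -size_filter; set bs := [seq _ <- _ | _].
have ubs : uniq bs by rewrite filter_uniq ?undup_uniq.
apply: le_trans (sum_bin_load_le e ubs s_ge0).
have -> : (size bs)%:R = \sum_(b <- bs) 1 :> R.
  by rewrite big_const_seq count_predT iter_addr_0.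
rewrite big_seq [leRHS]big_seq ler_sum // => b.
by rewrite mem_filter => /andP[].
Qed.

Lemma bin_load_map (R : realType) (s : seq R) p (h : nat -> nat) b :
  {in p &, injective h} -> b \in p ->
  bin_load s (map h p) (h b) = bin_load s p b.
Proof.
move=> hinj bp; rewrite /bin_load.
have {bp} : forall c, c \in p -> (h c == h b) = (c == b).
  by move=> c cp; apply/eqP/eqP => [/hinj->|->].
elim: s p {hinj} => [|x s IH] [|c p] /= hb; rewrite ?big_nil // !big_cons /=.
by rewrite hb ?mem_head // IH // => d dp; rewrite hb // inE dp orbT.
Qed.

Lemma bin_load_map_le (R : realType) (s : seq R) p (h : nat -> nat) b :
  size p = size s -> (forall x, x \in s -> 0 <= x) ->
  bin_load s p b <= bin_load s (map h p) (h b).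
Proof.
elim: s p => [|x s IH] [|c p] //= => [_ _|[e] s_ge0].
  by rewrite /bin_load !big_nil.
rewrite !bin_load_cons lerD //; last first.
  by apply: IH => // y ys; apply: s_ge0; rewrite inE ys orbT.
have x_ge0 : 0 <= x by apply: s_ge0; exact: mem_head.
by have [->|_] := eqVneq c b; rewrite ?eqxx //; case: ifP.
Qed.

Lemma covered_bins_map (R : realType) (s : seq R) p (h : nat -> nat) :
  {in p &, injective h} -> (covered_bins s p <= covered_bins s (map h p))%N.
Proof.
move=> hinj; rewrite {1}/covered_bins -size_filter; set bs := [seq _ <- _ | _].
have bsp : {subset bs <= p} by move=> b; rewrite mem_filter mem_undup => /andP[].
rewrite -(size_map h) covered_bins_ge //.
  rewrite map_inj_in_uniq ?filter_uniq ?undup_uniq //.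
  by move=> b c /bsp bp /bsp cp; apply: hinj.
move=> _ /mapP[b bbs ->]; rewrite bin_load_map ?bsp //.
by move: bbs; rewrite mem_filter => /andP[].
Qed.

(** [OPT] only ranges over labels below [size s], whereas an algorithm may use any labels. Numbering
    the labels of [p] by their position in [undup p] brings them into that range and keeps distinct
    bins distinct. *)
Lemma covered_bins_OPT (R : realType) (s : seq R) p :
  size p = size s -> (covered_bins s p <= OPT s)%N.
Proof.
move=> e; pose h b := index b (undup p).
have hlt b : b \in p -> (h b < size s)%N.
  by rewrite -mem_undup -index_mem -e => /leq_trans-> //; exact: size_undup.
have hinj : {in p &, injective h}.
  apply: (@can_in_inj _ _ [in p] h (nth 0%N (undup p))) => b bp.
  by rewrite /h nth_index ?mem_undup.
apply: leq_trans (covered_bins_map s hinj) _.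
case: (posnP (size s)) => [s0|s_gt0].
  by move: s0; rewrite -e => /size0nil->.
pose t := map (fun b => insubd (Ordinal s_gt0) (h b)) p.
have st : size t == size s by rewrite size_map e.
suff -> : map h p = map val (Tuple st) by apply: leq_bigmax.
rewrite /= /t -map_comp; apply/eq_in_map => b bp /=.
by rewrite val_insubd hlt.
Qed.

Lemma OPT_exists (R : realType) (s : seq R) :
  exists2 p, size p = size s & covered_bins s p = OPT s.
Proof.
have card_gt0 : (0 < #|{: (size s).-tuple 'I_(size s)}|)%N.
  by rewrite card_tuple card_ord; case: (size s) => [|n] //; rewrite expn_gt0.
have [t tE] := @bigop.eq_bigmax _ (fun p : (size s).-tuple 'I_(size s) =>
  covered_bins s (map val p)) card_gt0.
by exists (map val t); rewrite ?size_map ?size_tuple // -tE.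
Qed.

(** In an optimal packing the covered bins are renumbered from 0, and the contents of all the other
    bins are poured into bin 0. Loads of covered bins do not decrease, so they stay covered. The
    [maxn 1] accounts for [OPT s = 0], where bin 0 is still used. *)
Lemma OPT_exists_small (R : realType) (s : seq R) :
  (forall x, x \in s -> 0 <= x) ->
  exists p, [/\ size p = size s, covered_bins s p = OPT s &
    forall b, b \in p -> (b < maxn 1 (OPT s))%N].
Proof.
move=> s_ge0; have [p sp pE] := OPT_exists s.
pose bs := [seq b <- undup p | 1 <= bin_load s p b].
have sbs : size bs = OPT s by rewrite size_filter.
have ubs : uniq bs by rewrite filter_uniq ?undup_uniq.
pose h b := if b \in bs then index b bs else 0%N.
have hp : size (map h p) = size s by rewrite size_map.
exists (map h p); split=> //.
  apply/eqP; rewrite eqn_leq covered_bins_OPT //= -sbs -(size_iota 0 (size bs)).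
  apply: covered_bins_ge => [|j]; first exact: iota_uniq.
  rewrite mem_iota add0n /= => jlt; set b := nth 0%N bs j.
  have bbs : b \in bs by apply: mem_nth.
  have <- : h b = j by rewrite /h bbs index_uniq.
  have : 1 <= bin_load s p b by move: bbs; rewrite mem_filter => /andP[].
  by move=> /le_trans; apply; apply: bin_load_map_le.
move=> _ /mapP[b bp ->]; rewrite /h; case: ifP => [bbs|_].
  by rewrite leq_max -sbs index_mem bbs orbT.
by rewrite leq_max.
Qed.

(** * Sufficient advice *)

Fixpoint bits (a x : nat) : seq bool :=
  if a is a'.+1 then odd x :: bits a' x./2 else [::].

Lemma size_bits a x : size (bits a x) = a.
Proof. by elim: a x => //= a IH x; rewrite IH. Qed.

Lemma bits_inj a x y :
  (x < 2 ^ a)%N -> (y < 2 ^ a)%N -> bits a x = bits a y -> x = y.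
Proof.
elim: a x y => [|a IH] x y /=; first by rewrite expn0; lia.
rewrite expnS => xlt ylt [oxy hxy].
rewrite -(odd_double_half x) -(odd_double_half y) oxy.
by rewrite (IH x./2 y./2) //; lia.
Qed.

(* The numbers in [v] are meant to be smaller than [2 ^ a]. *)
Definition self_delimited (a : nat) (v : seq nat) : seq bool :=
  nseq a true ++ false :: nseq (size v) true ++ false :: flatten (map (bits a) v).

Lemma size_flatten_bits a v : size (flatten (map (bits a) v)) = (a * size v)%N.
Proof.
by elim: v => [|x v IH] /=; rewrite ?muln0 // size_cat size_bits IH mulnS.
Qed.

Lemma size_self_delimited a v :
  size (self_delimited a v) = (a.+1 * (size v).+1).+1.
Proof.
by rewrite /self_delimited !(size_cat, size_nseq) /= !(size_cat, size_nseq) /=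
  size_flatten_bits; lia.
Qed.

Lemma nseq_true_inj a b (x y : seq bool) :
  nseq a true ++ false :: x = nseq b true ++ false :: y -> a = b /\ x = y.
Proof. by elim: a b => [|a IH] [|b] //= [] => [->|/IH[-> ->]]. Qed.

Lemma self_delimited_inj a v a' v' :
  (forall x, x \in v -> (x < 2 ^ a)%N) -> (forall x, x \in v' -> (x < 2 ^ a')%N) ->
  self_delimited a v = self_delimited a' v' -> v = v'.
Proof.
move=> hv hv' /nseq_true_inj[ea /nseq_true_inj[]]; rewrite -{a'}ea in hv' *.
elim: v v' hv hv' => [|x v IH] [|x' v'] //= hv hv' [es] /eqP.
rewrite eqseq_cat ?size_bits // => /andP[/eqP ex /eqP ev].
rewrite (bits_inj (hv x _) (hv' x' _) ex) ?mem_head //.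
congr (_ :: _); apply: IH => // y yv; [apply: hv | apply: hv'];
  by rewrite inE yv orbT.
Qed.

(** The two unary headers determine [a] and [size v], hence the length of the whole code; a prefix
    of full length is everything. *)
Lemma self_delimited_prefix a v a' v' :
  prefix (self_delimited a v) (self_delimited a' v') ->
  self_delimited a v = self_delimited a' v'.
Proof.
move=> /prefixP[t]; rewrite /self_delimited -!catA /= => /nseq_true_inj[<-].
rewrite -catA /= => /nseq_true_inj[ev /esym e]; rewrite ev -e.
have /size0nil -> : size t = 0%N; last by rewrite cats0.
move/(congr1 size): e; rewrite size_cat !size_flatten_bits ev => /eqP.
by rewrite -[X in _ == X]addn0 eqn_add2l => /eqP.
Qed.

(** The algorithm reads until the bits read form a codeword; prefix-freeness guarantees that this
    does not happen before the end of [code s]. On an empty input no item arrives and nothing is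
    read, hence an inequality for [r]. *)
Lemma run_upfront (R : realType) (code : seq R -> seq bool)
    (place : seq R -> seq bool -> nat) :
  (forall s s', prefix (code s) (code s') -> code s = code s') ->
  exists (A : online_alg R) (O : oracle R), forall s,
    exists2 r, (r <= size (code s))%N &
      run A (O s) s (size s) r
        (mkseq (fun i => place (take i.+1 s) (code s)) (size s)).
Proof.
move=> pf.
pose A : online_alg R := fun t w =>
  if `[< exists s, w = code s >] then Some (place t w) else None.
pose O : oracle R := fun s => nth false (code s).
exists A, O => s; have [s0|s_gt0] := posnP (size s).
  by rewrite s0; exists 0%N => //; exact: run_start.
have tape r : (r <= size (code s))%N -> mkseq (O s) r = take r (code s).
  by move=> rle; rewrite -[in RHS](mkseq_nth false (code s)) /mkseq -map_take take_iota (minn_idPl rle).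
exists (size (code s)) => //.
have: (size s <= size s)%N by [].
elim: {1 3 4}(size s) => [_|i IH ilt]; last first.
  rewrite mkseqS; apply: run_place => //; first exact/IH/ltnW.
  rewrite tape // take_size /A; case: asboolP => // -[]; by exists s.
have: (size (code s) <= size (code s))%N by [].
elim: {1 3}(size (code s)) => [_|r IH rlt]; first exact: run_start.
apply: run_read => //; first exact/IH/ltnW.
rewrite tape ?(ltnW rlt) // /A; case: asboolP => // -[s' e].
(* A codeword met after only [r] bits would be a prefix of [code s], hence equal to it, which
   contradicts [r < size (code s)]. *)
have /pf e' : prefix (code s') (code s) by apply/prefixP; exists (drop r (code s)); rewrite -e cat_take_drop.
by move/(congr1 size): e; rewrite e' size_takel ?(ltnW rlt) // => e; move: rlt; rewrite e ltnn.
Qed.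

Lemma run_number_advice (R : realType) (a : seq R -> nat) (v : seq R -> seq nat)
    (place : seq R -> seq nat -> nat) :
  (forall s x, x \in v s -> (x < 2 ^ a s)%N) ->
  exists (A : online_alg R) (O : oracle R), forall s,
    exists2 r, (r <= ((a s).+1 * (size (v s)).+1).+1)%N &
      run A (O s) s (size s) r
        (mkseq (fun i => place (take i.+1 s) (v s)) (size s)).
Proof.
move=> hv; pose code s := self_delimited (a s) (v s).
(* Several inputs may share the code [w], but the numbers [v s] are the same for all of them. *)
pose decode w := xget [::] [set u | exists2 s, w = code s & u = v s].
have [|A [orc AO]] := @run_upfront R code (fun t w => place t (decode w)).
  by move=> s s'; exact: self_delimited_prefix.
exists A, orc => s; have [r rle] := AO s.
have -> : decode (code s) = v s.
  have : [set u | exists2 s', code s = code s' & u = v s'] (decode (code s)).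
    by apply: xgetPex; exists (v s), s.
  by case=> s' e ->; rewrite (self_delimited_inj (hv s) (hv s') e).
by exists r => //; rewrite -size_self_delimited.
Qed.

Lemma ln2_gt0 (R : realType) : 0 < ln 2 :> R.
Proof. by rewrite ln_gt0 // ltr1n. Qed.

Lemma number_advice_le (R : realType) (k b : nat) :
  (1 < k)%N -> (0 < b)%N ->
  ((up_log 2 k.+1).+1 * b.+1).+1%:R <= 10 / ln 2 * (b%:R * ln k%:R) :> R.
Proof.
move=> k_gt1 b_gt0; set a := up_log 2 k.+1.
have a_gt0 : (0 < a)%N by rewrite up_log_gt0; lia.
have l2 := ln2_gt0 R.
have hk : ln 2 <= ln k%:R :> R by rewrite ler_ln ?posrE ?ltr0n ?ler_nat // ltnW.
have ha : a%:R * ln 2 <= 2 * ln k%:R :> R.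
  (* Minimality of [a] gives [a - 1 <= log2 k], and the extra 1 is at most [log2 k] because
     [k >= 2]. *)
  have : (2 ^ a.-1 <= k)%N by rewrite -ltnS up_log_gtn // ltnW.
  move=> pow_le; have : ln (2 ^+ a.-1) <= ln k%:R :> R.
    by rewrite ler_ln ?posrE ?exprn_gt0 ?ltr0n ?(ltnW k_gt1) // -natrX ler_nat.
  have -> : a%:R = a.-1%:R + 1 :> R by rewrite natr1 prednK.
  rewrite lnXn ?ltr0n // -mulr_natl mulrDl mul1r => h; lra.
have -> : 10 / ln 2 * (b%:R * ln k%:R) = 5 * b%:R * (2 * ln k%:R / ln 2) :> R.
  by rewrite !mulrA; lra.
have b_ge0 : 0 <= 5 * b%:R :> R by rewrite mulr_ge0.
apply: le_trans (_ : 5 * b%:R * a%:R <= _).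
  2: by apply: ler_wpM2l => //; rewrite ler_pdivlMr.
(* Since [a] and [b] are positive, [(a + 1) * (b + 1) + 1] is at most [4 * a * b + 1], hence at most
   [5 * a * b]. *)
by rewrite -!natrM ler_nat; nia.
Qed.

Lemma OPT_le_size (R : realType) (s : seq R) : (OPT s <= size s)%N.
Proof.
have [p sp <-] := OPT_exists s; rewrite -sp.
by rewrite (leq_trans (count_size _ _)) ?size_undup.
Qed.

Lemma optimal_advice_upper_bound (R : realType) :
  exists (A : online_alg R) (O : oracle R) (C : R),
    forall s : seq R, all (@item_size R) s ->
      exists2 r : nat, optimal_reading A O s r &
        r%:R <= C * ((size s)%:R * ln (OPT s)%:R + 1).
Proof.
pose good (s : seq R) p := [/\ size p = size s, covered_bins s p = OPT s &
    forall b, b \in p -> (b < maxn 1 (OPT s))%N].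
(* When [OPT s <= 1] all items go to bin 0, so the list of labels is left empty: the code has two
   bits, paid for by the [+ 1] in the bound, and the default value of [nth] supplies the label 0. *)
pose a (s : seq R) := if (OPT s <= 1)%N then 0%N else up_log 2 (OPT s).+1.
pose v s := if (OPT s <= 1)%N then [::] else xget [::] (good s).
have [|A [orc AO]] := @run_number_advice R a v (fun t v => nth 0%N v (size t).-1).
  move=> s x; rewrite /v /a; case: ifP => // /negbT; rewrite -ltnNge => k_gt1.
  case: xgetP => [p _ [_ _ lt_p] /lt_p|//]; rewrite (maxn_idPr (ltnW k_gt1)).
  move=> /leq_trans; apply; apply: leq_trans (leqnSn _) _; exact: up_logP.
exists A, orc, (10 / ln 2 + 2) => s s_size.
have C_ge0 : 0 <= 10 / ln 2 :> R by rewrite divr_ge0 // ltW // ln2_gt0.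
have s_ge0 x : x \in s -> 0 <= x by move=> /(allP s_size) /andP[/ltW].
have [r rle] := AO s; set p := mkseq _ _ => pr.
have [p0 p0_good] := OPT_exists_small s_ge0.
have pE : exists2 p', good s p' & p = p'.
  rewrite /p /v; case: ifP => k1; last first.
    have [sp cp lt_p] : good s (xget [::] (good s)) by apply: xgetPex; exists p0.
    exists (xget [::] (good s)) => //; rewrite -{2}(mkseq_nth 0%N (xget _ _)) sp.
    by apply/eq_in_map => i; rewrite mem_iota /= => ilt; rewrite size_takel.
  exists p0 => //; have [sp _ lt_p] := p0_good; rewrite -sp.
  rewrite -{2}(mkseq_nth 0%N p0); apply/eq_in_map => i; rewrite mem_iota /= => ilt.
  rewrite nth_nil; apply/eqP; rewrite eq_sym -leqn0 -ltnS.
  by rewrite (leq_trans (lt_p _ (mem_nth _ ilt))) // geq_max k1.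
exists r; first by exists p => //; have [p' [_ <- _] ->] := pE.
apply: le_trans (_ : ((a s).+1 * (size (v s)).+1).+1%:R <= _).
  by rewrite ler_nat.
rewrite /a /v; case: ifP => k1.
  have -> : ln (OPT s)%:R = 0 :> R.
    by move: k1; case: (OPT s) => [|[]] //; rewrite ?ln1 ?ln0.
  by rewrite mulr0 add0r mulr1 lerDr.
have k_gt1 : (1 < OPT s)%N by rewrite ltnNge k1.
have -> : size (xget [::] (good s)) = size s.
  by have [] : good s (xget [::] (good s)) by apply: xgetPex; exists p0.
have n_gt0 := leq_trans (ltnW k_gt1) (OPT_le_size s).
apply: le_trans (number_advice_le _ k_gt1 n_gt0) _.
have : 0 <= (size s)%:R * ln (OPT s)%:R :> R.
  by rewrite mulr_ge0 // ln_ge0 // ler1n ltnW.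
rewrite mulrDr mulr1 mulrDl => h_ge0; lra.
Qed.

(* [pool] lists the items of a packing with their bins; an arriving item takes
   over the bin of the first item of its size that is left in [pool]. *)
Fixpoint assign (R : realType) (pool : seq (R * nat)) (s : seq R) : seq nat :=
  if s is x :: s' then
    let b := nth 0%N (unzip2 pool) (index x (unzip1 pool)) in
    b :: assign (rem (x, b) pool) s'
  else [::].

Lemma size_assign (R : realType) pool (s : seq R) : size (assign pool s) = size s.
Proof. by elim: s pool => //= x s IH pool; rewrite IH. Qed.

Lemma assign_take (R : realType) pool (s : seq R) i :
  assign pool (take i s) = take i (assign pool s).
Proof. by elim: s pool i => [|x s IH] pool [|i] //=; rewrite IH. Qed.

Lemma assign_perm (R : realType) pool (s : seq R) :
  perm_eq s (unzip1 pool) -> perm_eq (zip s (assign pool s)) pool.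
Proof.
elim: s pool => [|x s IH] pool /= e.
  by move: e; rewrite perm_sym => /perm_nilP; case: pool.
set b := nth _ _ _; have xp : x \in unzip1 pool by rewrite -(perm_mem e) mem_head.
have xbp : (x, b) \in pool.
  have ilt : (index x (unzip1 pool) < size pool)%N by rewrite -(size_map fst) index_mem.
  have -> : (x, b) = nth (0, 0%N) pool (index x (unzip1 pool)).
    transitivity (nth (0, 0%N) (zip (unzip1 pool) (unzip2 pool)) (index x (unzip1 pool))).
      by rewrite nth_zip ?size_map // nth_index.
    by rewrite zip_unzip.
  exact: mem_nth.
have ep := perm_to_rem xbp; rewrite perm_sym in ep.
apply: (perm_trans _ ep); rewrite perm_cons IH //.
rewrite -(perm_cons x) (perm_trans e) // perm_sym.
exact: (perm_map fst ep).
Qed.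

Lemma covered_bins_perm (R : realType) (s s' : seq R) p p' :
  size p = size s -> size p' = size s' -> perm_eq (zip s p) (zip s' p') ->
  covered_bins s p = covered_bins s' p'.
Proof.
move=> e e' zz; have pp : perm_eq p p'.
  have := perm_map snd zz; rewrite -/unzip2 !unzip2_zip ?e ?e' //.
rewrite /covered_bins; have /permP -> : perm_eq (undup p) (undup p').
  exact/perm_undup/perm_mem.
by apply: eq_count => b; rewrite /bin_load (perm_big _ zz).
Qed.

(** An optimal packing of [s'] serves as a pool for [assign], which transfers it to [s]. *)
Lemma perm_OPT_le (R : realType) (s s' : seq R) :
  perm_eq s s' -> (OPT s' <= OPT s)%N.
Proof.
move=> e; have [p sp <-] := OPT_exists s'.
have e' : perm_eq s (unzip1 (zip s' p)) by rewrite unzip1_zip ?sp.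
rewrite -(covered_bins_perm (s := s) (p := assign (zip s' p) s)) ?size_assign //.
  by rewrite covered_bins_OPT ?size_assign.
exact: assign_perm.
Qed.

Lemma mkseq_last_take (s : seq nat) :
  mkseq (fun i => last 0%N (take i.+1 s)) (size s) = s.
Proof.
rewrite -[RHS](mkseq_nth 0%N s); apply/eq_in_map => i; rewrite mem_iota /= => ilt.
by rewrite (take_nth 0%N) // last_rcons.
Qed.

Lemma sizes_upper_bound (R : realType) (S : seq R) : size_set S ->
  exists (A : online_alg R) (O : oracle R), forall s : seq R, {subset s <= S} ->
    exists2 r : nat, optimal_reading A O s r &
      (r <= ((up_log 2 (size s).+1).+1 * (size S).+1).+1)%N.
Proof.
move=> [uS S_size].
pose counts (s : seq R) := [seq count_mem x s | x <- S].
(* The pool is chosen from the multiplicities [w] alone, so the algorithm can reconstruct the same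
   pool as the oracle. Using it is an online procedure because [assign] commutes with taking
   prefixes. *)
pose pool_for w := xget [::] [set pool | [/\ counts (unzip1 pool) = w,
  {subset unzip1 pool <= S} &
  covered_bins (unzip1 pool) (unzip2 pool) = OPT (unzip1 pool)]].
have [|A [orc AO]] := @run_number_advice R (fun s => up_log 2 (size s).+1) counts
  (fun t w => last 0%N (assign (pool_for w) t)).
  move=> s _ /mapP[x _ ->]; apply: leq_trans (up_logP _ _) => //.
  by rewrite ltnS count_size.
exists A, orc => s sS; have [r rle pr] := AO s; exists r; last first.
  by rewrite size_map in rle.
have [p sp pE] := OPT_exists s.
have [cE poolS poolE] : [set pool | [/\ counts (unzip1 pool) = counts s,
  {subset unzip1 pool <= S} &
  covered_bins (unzip1 pool) (unzip2 pool) = OPT (unzip1 pool)]] (pool_for (counts s)).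
  by apply: xgetPex; exists (zip s p); split; rewrite ?unzip1_zip ?unzip2_zip ?sp.
set Z := pool_for _ in cE poolS poolE pr.
have sZ : perm_eq s (unzip1 Z).
  rewrite /perm_eq; apply/allP => x; rewrite mem_cat => xsZ.
  have xS : x \in S by case/orP: xsZ => [/sS|/poolS].
  by apply/eqP; move/eq_in_map: cE => ->.
exists (assign Z s).
  rewrite -(mkseq_last_take (assign Z s)) size_assign.
  congr run: pr; apply: eq_map => i.
  by rewrite assign_take.
rewrite (covered_bins_perm (s' := unzip1 Z) (p' := unzip2 Z)) ?size_assign ?size_map //.
  rewrite poolE; apply/eqP; rewrite eqn_leq !perm_OPT_le //.
  by rewrite perm_sym.
by rewrite zip_unzip assign_perm.
Qed.

(** * Runs sharing a prefix *)

Lemma run_size (R : realType) (A : online_alg R) tape s i r p :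
  run A tape s i r p -> size p = i /\ (i <= size s)%N.
Proof.
by elim=> // {i r p} i r p b _ [sp _] ilt _; rewrite size_rcons sp.
Qed.

(* Every step increments [i + r], so [i + r] counts the steps of a run. *)
Lemma run_last_step (R : realType) (A : online_alg R) tape s i r p n :
  run A tape s i r p -> (i + r)%N = n.+1 ->
  exists i0 r0 p0, [/\ run A tape s i0 r0 p0, (i0 + r0)%N = n &
    match A (take i0.+1 s) (mkseq tape r0) with
    | None => [/\ i = i0, r = r0.+1 & p = p0]
    | Some b => [/\ i = i0.+1, r = r0 & p = rcons p0 b]
    end].
Proof.
case=> {i r p} [//|i r p run0 ilt act|i r p b run0 ilt act] e.
- by exists i, r, p; split=> //; [lia | rewrite act].
- by exists i, r, p; split=> //; [lia | rewrite act].
Qed.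

(** Induction on the common number of steps: as long as both runs stay within the shared [j] items
    and [w] bits, they consult the algorithm on the same data. *)
Lemma run_det (R : realType) (A : online_alg R) tape tape' s s' j w
    i r p i' r' p' :
  take j s = take j s' -> mkseq tape w = mkseq tape' w ->
  run A tape s i r p -> run A tape' s' i' r' p' -> (i + r = i' + r')%N ->
  (i <= j)%N -> (r <= w)%N -> (i' <= j)%N -> (r' <= w)%N ->
  [/\ i = i', r = r' & p = p'].
Proof.
move=> es et; move e: (i + r)%N => n.
elim: n i r p i' r' p' e => [|n IH] i r p i' r' p' e run1 run2 e' ij rw ij' rw'.
  have [[i0 r0] [i0' r0']] : (i = 0 /\ r = 0)%N /\ (i' = 0 /\ r' = 0)%N by lia.
  rewrite {}i0 {}r0 in run1 *; rewrite {}i0' {}r0' in run2 *.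
  by have [/size0nil-> _] := run_size run1; have [/size0nil-> _] := run_size run2.
have [i0 [r0 [p0 [run1' e0 act1]]]] := run_last_step run1 e.
have [i0' [r0' [p0' [run2' e0' act2]]]] := run_last_step run2 (esym e').
have le1 : (i0 <= i)%N /\ (r0 <= r)%N.
  by move: act1; case: (A _ _) => [b|] [-> -> _]; lia.
have le2 : (i0' <= i')%N /\ (r0' <= r')%N.
  by move: act2; case: (A _ _) => [b|] [-> -> _]; lia.
have [||||ei er ep] := IH _ _ _ _ _ _ e0 run1' run2' (esym e0'); try lia.
move: act2; rewrite -ei -er -ep.
have <- : mkseq tape r0 = mkseq tape' r0.
  have takeE t : mkseq t r0 = take r0 (mkseq t w).
    by rewrite /mkseq -map_take take_iota; congr (map t (iota 0 _)); lia.
  by rewrite !takeE et.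
(* With [j] items already placed, the next item may differ between the inputs; but a placement would
   then exceed [j], so both steps can only be reads. *)
have [ltj|gej] := ltnP i0 j.
  have <- : take i0.+1 s = take i0.+1 s' by rewrite -(take_takel s ltj) es take_takel.
  by move: act1; case: (A _ _) => [b|] [-> -> ->] [-> -> ->].
move: act1; case: (A _ _) => [b|] [? ? ->]; case: (A _ _) => [b'|] [? ? ->]; try lia.
by split=> //; lia.
Qed.

(** Rewinds a run to any earlier step number, so that two runs can be compared after equally many
    steps. *)
Lemma run_back (R : realType) (A : online_alg R) tape s i r p m :
  run A tape s i r p -> (m <= i + r)%N ->
  exists i0 r0 p0, [/\ run A tape s i0 r0 p0, (i0 + r0)%N = m, (i0 <= i)%N,
    (r0 <= r)%N & p0 = take i0 p].
Proof.
elim=> {i r p} [|i r p run0 IH ilt act|i r p b run0 IH ilt act].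
- rewrite leqn0 => /eqP->; exists 0%N, 0%N, [::]; split=> //; exact: run_start.
- rewrite addnS leq_eqVlt => /orP[/eqP->|/IH].
    exists i, r.+1, p; split=> //; first exact: run_read; try by rewrite addnS.
    by have [sz _] := run_size run0; rewrite take_oversize ?sz.
  by move=> [i0 [r0 [p0 [run1 e ii rr pE]]]]; exists i0, r0, p0; split=> //; lia.
- rewrite addSn leq_eqVlt => /orP[/eqP->|/IH].
    have run1 := run_place run0 ilt act.
    exists i.+1, r, (rcons p b); split=> //; try by rewrite addSn.
    by have [sz _] := run_size run1; rewrite take_oversize ?sz.
  move=> [i0 [r0 [p0 [run1 e ii rr pE]]]]; exists i0, r0, p0; split=> //; try lia.
  by rewrite pE -cats1 takel_cat //; have [-> _] := run_size run0.
Qed.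

Lemma run_prefix (R : realType) (A : online_alg R) tape s i r p j :
  run A tape s i r p -> (j <= i)%N ->
  exists2 r0, (r0 <= r)%N & run A tape s j r0 (take j p).
Proof.
elim=> {i r p} [|i r p run0 IH ilt act|i r p b run0 IH ilt act].
- by rewrite leqn0 => /eqP->; exists 0%N => //; exact: run_start.
- by move=> /IH[r0 r0le run1]; exists r0 => //; exact: leqW.
- rewrite leq_eqVlt => /orP[/eqP->|].
    have run1 := run_place run0 ilt act; exists r => //.
    by have [sz _] := run_size run1; rewrite take_oversize ?sz.
  rewrite ltnS => ji; have [r0 r0le run1] := IH ji; exists r0 => //.
  by rewrite -cats1 takel_cat //; have [-> _] := run_size run0.
Qed.

Lemma run_prefix_eq (R : realType) (A : online_alg R) tape tape' s s' j w
    r p r' p' :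
  take j s = take j s' -> mkseq tape w = mkseq tape' w ->
  (j <= size s)%N -> (j <= size s')%N -> (r <= w)%N -> (r' <= w)%N ->
  run A tape s (size s) r p -> run A tape' s' (size s') r' p' ->
  take j p = take j p'.
Proof.
move=> es et js js' rw rw' /run_prefix-/(_ _ js)[q qr run1].
move=> /run_prefix-/(_ _ js')[q' qr' run2].
(* Both runs are stopped with [j] items placed. The one with more steps is rewound to the step
   number of the other; determinism then shows that it had placed [j] items there as well. *)
have [qq|/ltnW qq] := leqP q q'.
  have [|i0 [r0 [p0 [run0 e0 i0j r0q p0E]]]] := run_back (m := j + q) run2; first lia.
  have [||||ei _ ep] := run_det es et run1 run0 (esym e0); try lia.
  by rewrite ep p0E -ei take_takel.
have [|i0 [r0 [p0 [run0 e0 i0j r0q p0E]]]] := run_back (m := j + q') run1; first lia.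
have [||||ei _ ep] := run_det es et run0 run2 e0; try lia.
by rewrite -ep p0E ei take_takel.
Qed.

(** Pigeonhole: let [f] maximize the number of bits read. If two inputs had the same first [r f]
    tape bits, no run could tell them apart on the shared prefix, and one packing of this prefix
    would serve both. So these bits determine the input. *)
Lemma advice_lower_bound (R : realType) (A : online_alg R) (O : oracle R)
    (F : finType) (input : F -> seq R) (r : F -> nat) :
  (0 < #|F|)%N -> (forall f, optimal_reading A O (input f) (r f)) ->
  (forall f g p q, f != g ->
    size p = size (input f) -> covered_bins (input f) p = OPT (input f) ->
    size q = size (input g) -> covered_bins (input g) q = OPT (input g) ->
    exists j, [/\ (j <= size (input f))%N, (j <= size (input g))%N,
      take j (input f) = take j (input g) & take j p <> take j q]) ->
  exists f, (#|F| <= 2 ^ r f)%N.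
Proof.
move=> F_gt0 opt conflict.
have [f fE] := bigop.eq_bigmax r F_gt0; exists f.
pose advice (g : F) : (r f).-tuple bool := [tuple O (input g) i | i < r f].
have adviceE g : val (advice g) = mkseq (O (input g)) (r f).
  by rewrite /= /mkseq -val_enum_ord -map_comp.
suff /leq_card : injective advice by rewrite card_tuple card_bool.
move=> g h e; apply/eqP/negPn/negP => gh.
have [p run_p cov_p] := opt g; have [q run_q cov_q] := opt h.
have [sp _] := run_size run_p; have [sq _] := run_size run_q.
have [j [jg jh es []]] := conflict g h p q gh sp cov_p sq cov_q.
apply: (run_prefix_eq es _ jg jh _ _ run_p run_q (w := r f)).
- by rewrite -!adviceE e.
- by rewrite -fE leq_bigmax.
- by rewrite -fE leq_bigmax.
Qed.

(** * Small items followed by complements *)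

Definition with_complements (R : realType) (u g : seq R) : seq R :=
  u ++ [seq 1 - y | y <- g].

Lemma size_with_complements (R : realType) (u g : seq R) :
  size (with_complements u g) = (size u + size g)%N.
Proof. by rewrite size_cat size_map. Qed.

Lemma bin_load_le_sum (R : realType) (s : seq R) p b :
  size p = size s -> (forall x, x \in s -> 0 <= x) ->
  bin_load s p b <= \sum_(x <- s) x.
Proof.
move=> sp s_ge0; have := sum_bin_load_le (bs := [:: b]) sp isT s_ge0.
by rewrite big_seq1.
Qed.

Lemma bin_load_uniq (R : realType) (s : seq R) c j :
  uniq c -> size c = size s -> (j < size s)%N ->
  bin_load s c (nth 0%N c j) = nth 0 s j.
Proof.
elim: s c j => [|x s IH] [|d c] [|j] //= /andP[dc uc] [sc] js; rewrite bin_load_cons.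
  by rewrite eqxx bin_load_notin ?addr0.
rewrite IH // ifN ?add0r //; apply: contraNneq dc => ->.
by rewrite mem_nth // sc.
Qed.

Lemma eq_seq_of_sum_le (R : realType) (g a : seq R) :
  size a = size g -> (forall j, (j < size g)%N -> nth 0 g j <= nth 0 a j) ->
  \sum_(x <- a) x <= \sum_(x <- g) x -> a = g.
Proof.
move=> e ga sag.
have sumE (s : seq R) : \sum_(x <- s) x = \sum_(j < size s) nth 0 s j.
  by rewrite (big_nth 0) big_mkord.
apply: (@eq_from_nth _ 0) => // j; rewrite e => jg.
move: sag; rewrite !sumE e (bigD1 (Ordinal jg)) //= [leRHS](bigD1 (Ordinal jg)) //=.
have : \sum_(i < size g | i != Ordinal jg) nth 0 g i
    <= \sum_(i < size g | i != Ordinal jg) nth 0 a i by apply: ler_sum => i _; exact: ga.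
by have := ga j jg; lra.
Qed.

Lemma covered_with_complements (R : realType) (u g : seq R) p b :
  (forall x, x \in u -> 0 <= x) -> \sum_(x <- u) x < 1 ->
  size p = size (with_complements u g) ->
  1 <= bin_load (with_complements u g) p b -> b \in drop (size u) p.
Proof.
move=> u_ge0 u_lt1; rewrite size_with_complements => sp.
have sq : size (take (size u) p) = size u by rewrite size_takel // sp leq_addr.
rewrite -{1}(cat_take_drop (size u) p) bin_load_cat //; apply: contraLR => bc.
rewrite (bin_load_notin _ bc) addr0 -ltNge.
by apply: le_lt_trans u_lt1; exact: bin_load_le_sum.
Qed.

Lemma covered_with_complements_le (R : realType) (u g : seq R) p :
  (forall x, x \in u -> 0 <= x) -> \sum_(x <- u) x < 1 ->
  size p = size (with_complements u g) ->
  (covered_bins (with_complements u g) p <= size g)%N.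
Proof.
move=> u_ge0 u_lt1 sp; have -> : size g = size (drop (size u) p).
  by rewrite size_drop sp size_with_complements addKn.
rewrite /covered_bins -size_filter uniq_leq_size ?filter_uniq ?undup_uniq //.
by move=> b; rewrite mem_filter => /andP[/covered_with_complements-> ].
Qed.

(** The complement [1 - y] goes to the bin in which [q] has put small items of total size [y],
    filling it to exactly 1. *)
Lemma OPT_with_complements (R : realType) (u g : seq R) q :
  (forall x, x \in u -> 0 <= x) -> \sum_(x <- u) x < 1 ->
  size q = size u -> (forall j, (j < size g)%N -> bin_load u q j = nth 0 g j) ->
  OPT (with_complements u g) = size g.
Proof.
move=> u_ge0 u_lt1 sq loads; apply/eqP; rewrite eqn_leq; apply/andP; split.
  have [p sp <-] := OPT_exists (with_complements u g).
  exact: covered_with_complements_le.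
apply: (@leq_trans (covered_bins (with_complements u g) (q ++ iota 0 (size g)))).
  rewrite -{1}(size_iota 0 (size g)); apply: covered_bins_ge; first exact: iota_uniq.
  move=> j; rewrite mem_iota add0n => /andP[_ jg].
  have jE : nth 0%N (iota 0 (size g)) j = j by rewrite nth_iota.
  have -> : bin_load (with_complements u g) (q ++ iota 0 (size g)) j = 1; last by [].
  rewrite bin_load_cat // loads // -[X in bin_load _ _ X]jE.
  by rewrite bin_load_uniq ?iota_uniq ?size_iota ?size_map // (nth_map 0) // addrC subrK.
by apply: covered_bins_OPT; rewrite size_with_complements size_cat sq size_iota.
Qed.

(* Since [u] alone cannot cover a bin, each covered bin holds exactly one
   complement [1 - y], hence items of [u] of total size at least [y]; these
   lower bounds add up to the total size of [u]. *)
Lemma optimal_with_complements (R : realType) (u g : seq R) p :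
  (forall x, x \in u -> 0 <= x) -> \sum_(x <- u) x < 1 ->
  \sum_(y <- g) y = \sum_(x <- u) x -> size p = size (with_complements u g) ->
  covered_bins (with_complements u g) p = size g ->
  let load := bin_load u (take (size u) p) in let c := drop (size u) p in
  [/\ uniq c, map load c = g & forall b, b \notin c -> load b = 0].
Proof.
move=> u_ge0 u_lt1 sum_g sp cov load c.
have sq : size (take (size u) p) = size u.
  by rewrite size_takel // sp size_with_complements leq_addr.
have sc : size c = size g by rewrite size_drop sp size_with_complements addKn.
pose bs := [seq b <- undup p | 1 <= bin_load (with_complements u g) p b].
have ubs : uniq bs by rewrite filter_uniq ?undup_uniq.
have bsc : {subset bs <= c}.
  by move=> b; rewrite mem_filter => /andP[/covered_with_complements->].
have sbs : (size c <= size bs)%N by rewrite size_filter -/(covered_bins _ _) cov sc.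
have uc : uniq c by exact: leq_size_uniq sbs.
have [_ bscE] := uniq_min_size ubs bsc sbs.
have sum_load : \sum_(b <- c) load b <= \sum_(x <- u) x by exact: sum_bin_load_le.
have loadE : map load c = g.
  apply: eq_seq_of_sum_le; rewrite ?size_map //; last by rewrite big_map sum_g.
  move=> j jg; rewrite (nth_map 0%N) ?sc //.
  have : nth 0%N c j \in bs by rewrite bscE mem_nth ?sc.
  rewrite mem_filter -{1}(cat_take_drop (size u) p) bin_load_cat // => /andP[+ _].
  by rewrite bin_load_uniq ?size_map // (nth_map 0) // -/load; lra.
split=> // b bc; apply/eqP; rewrite eq_le bin_load_ge0 // andbT.
have := sum_bin_load_le (bs := b :: c) sq; rewrite /= bc uc => /(_ isT u_ge0).
by rewrite big_cons -sum_g -loadE big_map -/load; lra.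
Qed.

(** In an optimal packing the nonzero loads of the small items are, up to order, the nonzero entries
    of [g]. The packing of the common prefix [u] therefore reveals these entries. *)
Lemma perm_complements (R : realType) (u g g' : seq R) p p' :
  (forall x, x \in u -> 0 <= x) -> \sum_(x <- u) x < 1 ->
  \sum_(y <- g) y = \sum_(x <- u) x -> size p = size (with_complements u g) ->
  covered_bins (with_complements u g) p = size g ->
  \sum_(y <- g') y = \sum_(x <- u) x -> size p' = size (with_complements u g') ->
  covered_bins (with_complements u g') p' = size g' ->
  take (size u) p = take (size u) p' ->
  perm_eq [seq y <- g | y != 0] [seq y <- g' | y != 0].
Proof.
move=> u_ge0 u_lt1 sg sp cp sg' sp' cp' e.
have [uc loadE load0] := optimal_with_complements u_ge0 u_lt1 sg sp cp.
have [uc' loadE' load0'] := optimal_with_complements u_ge0 u_lt1 sg' sp' cp'.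
rewrite -e in loadE' load0'; rewrite -loadE -loadE' !filter_map perm_map //.
apply: uniq_perm; rewrite ?filter_uniq // => b; rewrite !mem_filter /=.
case: eqP => //= lb; apply/idP/idP => _; apply/negP.
  by move/negP/load0'.
by move/negP/load0.
Qed.

(** The conflicting prefix is [u]. The labelling [q f] realizes the loads [g f], which makes [k] the
    optimum; a zero entry of [g f] stands for an empty part and yields an item of size 1. *)
Lemma advice_lower_bound_complements (R : realType) (A : online_alg R)
    (O : oracle R) (P : seq R -> Prop) (F : finType) (u : seq R)
    (g : F -> seq R) (q : F -> seq nat) (k : nat) :
  (0 < #|F|)%N -> (forall x, x \in u -> 0 <= x) -> \sum_(x <- u) x < 1 ->
  (forall f, size (g f) = k) ->
  (forall f, \sum_(y <- g f) y = \sum_(x <- u) x) ->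
  (forall f, size (q f) = size u) ->
  (forall f j, (j < k)%N -> bin_load u (q f) j = nth 0 (g f) j) ->
  (forall f f', perm_eq [seq y <- g f | y != 0] [seq y <- g f' | y != 0] -> f = f') ->
  optimal_on A O P ->
  (forall f, OPT (with_complements u (g f)) = k -> P (with_complements u (g f))) ->
  exists f r, [/\ OPT (with_complements u (g f)) = k,
    optimal_reading A O (with_complements u (g f)) r & (#|F| <= 2 ^ r)%N].
Proof.
move=> F_gt0 u_ge0 u_lt1 sg sum_g sq loads g_inj opt gP.
have OPTE f : OPT (with_complements u (g f)) = k.
  rewrite -(sg f); apply: (OPT_with_complements (q := q f)) => // j.
  by rewrite sg; exact: loads.
have /choice[r rP] f : exists r, optimal_reading A O (with_complements u (g f)) r.
  by apply: opt; exact: gP.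
have [|f fr] := advice_lower_bound F_gt0 rP; last by exists f, (r f).
move=> f f' p p' ff' sp cp sp' cp'; exists (size u).
rewrite !size_with_complements !leq_addr; split=> //.
  by rewrite !take_size_cat.
move=> e; move/eqP: ff'; apply; apply: g_inj.
by apply: perm_complements e; rewrite ?cp ?cp' ?OPTE ?sg.
Qed.

(** * Powers of two and the lower bound for sparse inputs *)

Lemma bin_load_mkseq (R : realType) (a : nat -> R) q n b :
  bin_load (mkseq a n) (mkseq q n) b = \sum_(0 <= i < n | q i == b) a i.
Proof. by rewrite /bin_load /mkseq zip_map big_map /index_iota subn0. Qed.

Lemma sum_pow2_lt n : (\sum_(i <- iota 0 n) 2 ^ i < 2 ^ n)%N.
Proof.
elim: n => [|n IH]; first by rewrite big_nil.
by rewrite -[n.+1]addn1 iotaD big_cat big_seq1 /= add0n expnD expn1; lia.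
Qed.

Lemma sum_pow2_inj n (a b : pred nat) :
  (\sum_(0 <= i < n | a i) 2 ^ i = \sum_(0 <= i < n | b i) 2 ^ i)%N ->
  forall i, (i < n)%N -> a i = b i.
Proof.
elim: n a b => [|n IH] a b // e i.
have sumE c : (\sum_(0 <= i < n.+1 | c i) 2 ^ i =
    c 0 + (\sum_(0 <= i < n | c i.+1) 2 ^ i).*2)%N.
  rewrite big_mkcond big_nat_recl //= -mul2n big_distrr /= [in RHS]big_mkcond /=.
  congr (_ + _)%N.
  by apply: eq_bigr => j _; case: ifP; rewrite ?expnS.
move: e; rewrite !sumE => e; have [e0 e1] : a 0%N = b 0%N /\
    (\sum_(0 <= i < n | a i.+1) 2 ^ i = \sum_(0 <= i < n | b i.+1) 2 ^ i)%N.
  by move: e; case: (a 0%N); case: (b 0%N); lia.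
case: i => [|i] //; exact: (IH (fun i => a i.+1) (fun i => b i.+1)).
Qed.

Lemma mem_le_sum (R : realType) (s : seq R) x :
  (forall y, y \in s -> 0 <= y) -> x \in s -> x <= \sum_(y <- s) y.
Proof.
move=> s_ge0 xs; rewrite (big_rem x) //= lerDl big_seq sumr_ge0 // => y /mem_rem.
exact: s_ge0.
Qed.

Lemma with_complements_item_size (R : realType) (u g : seq R) :
  (forall x, x \in u -> 0 < x) -> (forall y, y \in g -> 0 <= y) ->
  \sum_(y <- g) y = \sum_(x <- u) x -> \sum_(x <- u) x < 1 ->
  all (@item_size R) (with_complements u g).
Proof.
move=> u_gt0 g_ge0 sum_g u_lt1; apply/allP => x; rewrite mem_cat /item_size.
case/orP=> [xu|/mapP[y yg ->]].
  have := mem_le_sum (fun z zu => ltW (u_gt0 z zu)) xu; have := u_gt0 x xu; lra.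
by have := mem_le_sum g_ge0 yg; have := g_ge0 y yg; lra.
Qed.

Lemma ln_le_of_le_pow2 (R : realType) (M r : nat) :
  (0 < M)%N -> (M <= 2 ^ r)%N -> ln M%:R <= r%:R :> R.
Proof.
(* Since [ln 2 <= 1], passing from binary to natural logarithms costs no constant in lower
   bounds. *)
move=> M_gt0 Mr; have ln2_le1 : ln 2 <= 1 :> R by have := @le_ln1Dx R 1; lra.
apply: (@le_trans _ _ (ln (2 ^ r)%:R)).
  by rewrite ler_ln ?posrE ?ltr0n ?expn_gt0 // ler_nat.
by rewrite natrX lnXn ?ltr0n // -[ln _ *+ _]mulr_natl ler_piMr.
Qed.

Lemma optimal_advice_lower_bound (R : realType) (eps : R) : 0 < eps ->
  forall n k : nat, (0 < k)%N -> 2 * k%:R <= (1 - eps) * n%:R ->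
  forall (A : online_alg R) (O : oracle R),
    optimal_on A O (sparse_input eps n) ->
    exists (s : seq R) (r : nat),
      [/\ sparse_input eps n s, OPT s = k, optimal_reading A O s r &
          eps * (n%:R * ln k%:R) <= r%:R].
Proof.
move=> eps_gt0 n k k_gt0 kn A orc opt.
have n_gt0 : (0 < n)%N.
  rewrite lt0n; apply: contraTneq kn => ->; rewrite mulr0 -ltNge mulr_gt0 //.
  by rewrite ltr0n.
have kn2 : (2 * k <= n)%N.
  rewrite -(ler_nat R) natrM (le_trans kn) // ler_piMl //; lra.
(* [N] small items and [k] complements make [n] items. Of the small ones, [d = N - k] are placed
   freely, giving [k ^ d] inputs. The factor [eta] keeps the total size of the small items below
   1. *)
pose N := (n - k)%N; pose d := (n - 2 * k)%N; pose F := {ffun 'I_d -> 'I_k}.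
pose eta : R := (2 ^ N)%:R^-1.
have eta_gt0 : 0 < eta by rewrite invr_gt0 ltr0n expn_gt0.
pose a i : R := (2 ^ i)%:R * eta.
have a_gt0 i : 0 < a i by rewrite mulr_gt0 // ltr0n expn_gt0.
pose u := mkseq a N.
(* The first [k] items lie in distinct bins, so that the partition of [u]
   determines the labelling [f] of the other items. *)
pose lab (f : F) i := if insub (i - k)%N is Some z then
  if (i < k)%N then i else val (f z) else i.
pose q f := mkseq (lab f) N.
pose g f := mkseq (bin_load u (q f)) k.
have lab_lt f i : (i < N)%N -> (lab f i < k)%N.
  move=> iN; rewrite /lab; case: insubP => [z _ _|]; first by case: ifP => // _; exact: ltn_ord.
  by rewrite -leqNgt /d; move: iN; rewrite /N; lia.
have lab_small f i : (i < k)%N -> lab f i = i.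
  by move=> ik; rewrite /lab ik; case: insub.
have sq f : size (q f) = size u by rewrite !size_mkseq.
have u_ge0 x : x \in u -> 0 <= x by case/mapP => i _ ->; exact: ltW.
have u_lt1 : \sum_(x <- u) x < 1.
  rewrite big_map -mulr_suml -natr_sum /eta ltr_pdivrMr ?ltr0n ?expn_gt0 // mul1r.
  by rewrite ltr_nat sum_pow2_lt.
have F_gt0 : (0 < #|F|)%N by rewrite card_ffun !card_ord expn_gt0 k_gt0.
have sum_g f : \sum_(y <- g f) y = \sum_(x <- u) x.
  rewrite big_map; apply: sum_bin_load_all; rewrite ?iota_uniq //.
  by move=> _ /mapP[i + ->]; rewrite !mem_iota !add0n /= => /lab_lt.
have g_neq0 f : [seq y <- g f | y != 0] = g f.
  apply/all_filterP/allP => _ /mapP[j + ->]; rewrite mem_iota add0n /= => jk.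
  have jN : (j < N)%N by rewrite /N; lia.
  rewrite gt_eqF // bin_load_mkseq big_mkcond /=.
  rewrite (bigD1_seq j) ?iota_uniq ?mem_index_iota //= lab_small // eqxx.
  by rewrite ltr_wpDr // sumr_ge0 // => i _; case: ifP => // _; exact: ltW.
have load_nat f j : bin_load u (q f) j = (\sum_(0 <= i < N | lab f i == j) 2 ^ i)%:R * eta.
  by rewrite bin_load_mkseq natr_sum mulr_suml.
have [||f|f j jk|f f'||f OPTE|f [r [OPTE fr Fr]]] :=
  @advice_lower_bound_complements R A orc (sparse_input eps n) F u g q k F_gt0 u_ge0 u_lt1.
- by move=> f; rewrite size_mkseq.
- exact: sum_g.
- exact: sq.
- by rewrite nth_mkseq.
- rewrite !g_neq0 => e; have lab_eq i : (i < N)%N -> lab f i = lab f' i.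
    move=> iN; have := lab_lt f i iN; move jE : (lab f i) => j jk.
    have jN : (j < N)%N by rewrite /N; lia.
    have : bin_load u (q f) j \in g f' by rewrite -(perm_mem e) map_f // mem_iota.
    (* Equal loads have equal binary digits, so part [j] of [f] and part [j'] of [f'] contain the
       same items. Item [j] is among them and has label [j] under both labellings, whence
       [j = j']. *)
    case/mapP=> j' _; rewrite !load_nat => /(mulIf (lt0r_neq0 eta_gt0)) /eqP.
    rewrite eqr_nat => /eqP/sum_pow2_inj same.
    have := same j jN; rewrite !(lab_small _ _ jk) eqxx => /esym/eqP jj'.
    by have := same i iN; rewrite -jj' jE eqxx => /esym/eqP.
  apply/ffunP => o; apply/val_inj.
  have [oN ok] : (k + o < N)%N /\ (k + o - k)%N = o.
    by have := ltn_ord o; rewrite /d /N; lia.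
  by have := lab_eq _ oN; rewrite /lab ok valK ltnNge leq_addr.
- exact: opt.
- split; last by rewrite OPTE.
    apply: with_complements_item_size; rewrite ?sum_g //.
      by move=> _ /mapP[i _ ->].
    by move=> _ /mapP[i _ ->]; exact: bin_load_ge0.
  by rewrite size_with_complements !size_mkseq /N subnK //; lia.
exists (with_complements u (g f)), r; split=> //.
  split; last by rewrite OPTE.
    apply: with_complements_item_size; rewrite ?sum_g //.
      by move=> _ /mapP[i _ ->].
    by move=> _ /mapP[i _ ->]; exact: bin_load_ge0.
  by rewrite size_with_complements !size_mkseq /N subnK //; lia.
rewrite card_ffun !card_ord in Fr; have M_gt0 : (0 < k ^ d)%N by rewrite expn_gt0 k_gt0.
apply: le_trans (ln_le_of_le_pow2 R M_gt0 Fr).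
(* The assumption on [k] says precisely that [d = n - 2 * k] is at least [eps * n]. *)
rewrite natrX lnXn ?ltr0n // -[ln _ *+ _]mulr_natl mulrA ler_wpM2r ?ln_ge0 ?ler1n //.
by rewrite /d natrB // natrM; lra.
Qed.

(** * Lower bounds for known item sizes *)

Fixpoint group_labels (T : Type) k (G : seq (seq T)) : seq nat :=
  if G is t :: G' then nseq (size t) k ++ group_labels k.+1 G' else [::].

Lemma size_group_labels (T : Type) k (G : seq (seq T)) :
  size (group_labels k G) = size (flatten G).
Proof. by elim: G k => //= t G IH k; rewrite !size_cat size_nseq IH. Qed.

Lemma bin_load_nseq (R : realType) (t : seq R) k b :
  bin_load t (nseq (size t) k) b = if k == b then \sum_(x <- t) x else 0.
Proof.
elim: t => [|x t IH]; first by rewrite /bin_load !big_nil if_same.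
by rewrite /= bin_load_cons IH big_cons; case: ifP => // _; rewrite addr0.
Qed.

Lemma group_labels_ge (T : Type) k (G : seq (seq T)) b :
  b \in group_labels k G -> (k <= b)%N.
Proof.
elim: G k => //= t G IH k; rewrite mem_cat mem_nseq => /orP[/andP[_ /eqP->]//|].
by move=> /IH/ltnW.
Qed.

Lemma bin_load_group_labels (R : realType) k (G : seq (seq R)) j :
  bin_load (flatten G) (group_labels k G) (k + j) = \sum_(x <- nth [::] G j) x.
Proof.
elim: G k j => [|t G IH] k j; first by rewrite nth_nil /bin_load !big_nil.
rewrite /= bin_load_cat ?size_nseq // bin_load_nseq.
case: j => [|j] /=; last by rewrite -addSnnS IH ifN ?add0r //; apply/eqP; lia.
rewrite addn0 eqxx bin_load_notin ?addr0 //; apply/negP => /group_labels_ge.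
by rewrite ltnn.
Qed.

Lemma flatten_flatten_map (I : Type) (T : eqType) (G : I -> seq (seq T)) (s : seq I) :
  flatten (flatten [seq G i | i <- s]) = flatten [seq flatten (G i) | i <- s].
Proof. by elim: s => //= i s IH; rewrite flatten_cat IH. Qed.

(* The odd numerators make an item distinct from any other item and from the
   sum of two equal items. *)
Definition gadget_item (R : realType) (n i : nat) : R :=
  (2 * i + 1)%:R / (n * n).+1%:R.

(** Each of [l] sizes occurs [2 * E] times among the small items, and for each the number of pairs
    is chosen freely between 0 and [E]. The sizes of the complements are [1 - x], [1 - 2x], and 1
    for the empty parts that pad the input to length [n]. *)
Lemma gadgets_lower_bound (R : realType) (n l E : nat) (S : seq R) :
  (0 < E)%N -> (4 * (E * l) <= n)%N ->
  (forall i, (i < l)%N -> gadget_item R n i \in S) ->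
  (forall i, (i < l)%N -> 1 - gadget_item R n i \in S) ->
  (forall i, (i < l)%N -> 1 - (gadget_item R n i + gadget_item R n i) \in S) ->
  1 \in S ->
  forall (A : online_alg R) (O : oracle R),
    optimal_on A O (fun s => size s = n /\ {subset s <= S}) ->
    exists (s : seq R) (r : nat),
      [/\ size s = n, {subset s <= S}, optimal_reading A O s r &
          (E.+1 ^ l <= 2 ^ r)%N].
Proof.
move=> E_gt0 El_n S1 S2 S3 S4 A orc opt.
pose x (i : 'I_l) := gadget_item R n i; pose F := {ffun 'I_l -> 'I_E.+1}.
have x_gt0 i : 0 < x i by rewrite divr_gt0 // ltr0n addn1.
pose u := flatten [seq nseq (2 * E) (x i) | i <- enum 'I_l].
pose gadget (f : F) i :=
  nseq (2 * (E - f i)) [:: x i] ++ nseq (f i) [:: x i; x i].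
pose groups f := flatten [seq gadget f i | i <- enum 'I_l].
pose k := (n - 2 * E * l)%N.
pose G f := groups f ++ nseq (k - size (groups f)) [::].
pose g f := [seq \sum_(y <- t) y | t <- G f].
pose q f := group_labels 0 (G f).
have flattenG f : flatten (G f) = u.
  rewrite flatten_cat flatten_flatten_map.
  have -> m : flatten (nseq m [::]) = [::] :> seq R by elim: m.
  rewrite cats0; congr flatten; apply: eq_map => i; rewrite flatten_cat.
  have fE := ltn_ord (f i).
  have -> m : flatten (nseq m [:: x i]) = nseq m (x i) by elim: m => //= m ->.
  have -> m : flatten (nseq m [:: x i; x i]) = nseq (2 * m) (x i).
    by elim: m => // m IH; rewrite mulnS (nseqD 2) /= IH.
  by rewrite -nseqD; congr nseq; lia.
have size_u : size u = (2 * E * l)%N.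
  rewrite size_flatten /shape -map_comp.
  rewrite (eq_map (g := fun=> (2 * E)%N)); last by move=> i /=; rewrite size_nseq.
  by rewrite sumnE big_map big_enum sum_nat_const card_ord mulnC.
have size_groups f : (size (groups f) <= k)%N.
  apply: (@leq_trans (2 * E * l)); last by rewrite /k; lia.
  rewrite size_flatten /shape -map_comp sumnE big_map big_enum /=.
  apply: (@leq_trans (\sum_(i < l) 2 * E)%N); last by rewrite sum_nat_const card_ord mulnC.
  apply: leq_sum => i _.
  by rewrite size_cat !size_nseq; have := ltn_ord (f i); lia.
have size_g f : size (g f) = k.
  by rewrite size_map size_cat size_nseq subnKC.
have size_q f : size (q f) = size u by rewrite size_group_labels flattenG.
have u_gt0 y : y \in u -> 0 < y.
  by case/flatten_mapP => i _ /nseqP[-> _].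
have u_ge0 y : y \in u -> 0 <= y by move/u_gt0/ltW.
have u_lt1 : \sum_(y <- u) y < 1.
  have ln : (l <= n)%N by nia.
  (* There are [2 * E * l] small items, and [4 * E * l * l <= n * l <= n * n] stays below the
     denominator. *)
  have u_le y : y \in u -> y <= (2 * l)%:R / (n * n).+1%:R.
    case/flatten_mapP => i _ /nseqP[-> _].
    by rewrite ler_wpM2r ?invr_ge0 // ler_nat; have := ltn_ord i; lia.
  apply: (@le_lt_trans _ _ (\sum_(y <- u) (2 * l)%:R / (n * n).+1%:R)).
    by rewrite big_seq [leRHS]big_seq ler_sum.
  rewrite big_const_seq count_predT iter_addr_0 size_u -[_ *+ (2 * E * l)]mulr_natl mulrA -natrM.
  by rewrite ltr_pdivrMr ?ltr0n // mul1r ltr_nat; nia.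
have sum_g f : \sum_(y <- g f) y = \sum_(y <- u) y.
  by rewrite big_map -(flattenG f) big_flatten.
have g_ge0 f y : y \in g f -> 0 <= y.
  case/mapP => t tG ->; rewrite big_seq sumr_ge0 // => z zt; apply: u_ge0.
  by rewrite -(flattenG f); apply/flattenP; exists t.
(* Only the singletons of size [x i] contribute, so this count recovers [f i]. *)
have count_g f i : count (pred1 (x i)) (g f) = (2 * (E - f i))%N.
  have D_neq0 : (n * n).+1%:R^-1 != 0 :> R by rewrite invr_eq0 pnatr_eq0.
  have xE j : (x j == x i) = (j == i).
    rewrite /x /gadget_item (inj_eq (mulIf D_neq0)) eqr_nat -(inj_eq val_inj) /=.
    by apply/eqP/eqP; lia.
  have xxE j : (x j + x j == x i) = false.
    rewrite /x /gadget_item -mulrDl (inj_eq (mulIf D_neq0)) -natrD eqr_nat.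
    by apply/eqP; lia.
  rewrite count_map count_cat count_nseq [X in (X * _)%N](_ : _ = 0%N); last first.
    by rewrite /= big_nil eq_sym gt_eqF.
  rewrite mul0n addn0.
  rewrite /groups count_flatten sumnE 2!big_map big_enum /= (bigD1 i) //= big1 ?addn0 => [|j ji].
    by rewrite count_cat !count_nseq /= !big_cons !big_nil !addr0 eqxx xxE mul1n addn0.
  by rewrite count_cat !count_nseq /= !big_cons !big_nil !addr0 xE xxE (negbTE ji).
have F_gt0 : (0 < #|F|)%N by rewrite card_ffun !card_ord expn_gt0.
have S_in f : {subset with_complements u (g f) <= S}.
  move=> y; rewrite mem_cat => /orP[/flatten_mapP[i _ /nseqP[-> _]]|]; first exact: S1.
  case/mapP => _ /mapP[t + ->] ->; rewrite mem_cat => /orP[/flatten_mapP[i _]|].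
    rewrite mem_cat => /orP[] /nseqP[-> _].
      by rewrite big_seq1 S2.
    by rewrite big_cons big_seq1 S3.
  by move=> /nseqP[-> _]; rewrite big_nil subr0.
have size_in f : size (with_complements u (g f)) = n.
  by rewrite size_with_complements size_u size_g subnKC //; lia.
have [||f|f j jk|f f' e||f _|f [r [_ fr Fr]]] :=
  @advice_lower_bound_complements R A orc (fun s => size s = n /\ {subset s <= S})
    F u g q k F_gt0 u_ge0 u_lt1.
- exact: size_g.
- exact: sum_g.
- exact: size_q.
- rewrite -(flattenG f) -[j]add0n bin_load_group_labels (nth_map [::]) //.
  by have := size_g f; rewrite size_map => ->.
- apply/ffunP => i; apply/val_inj.
  have : count (pred1 (x i)) (g f) = count (pred1 (x i)) (g f').
    have cE h : count (pred1 (x i)) (g h) = count (pred1 (x i)) [seq y <- g h | y != 0].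
      rewrite count_filter; apply: eq_count => y /=.
      by case: eqP => //= ->; rewrite gt_eqF.
    by rewrite !cE; exact/permP.
  by rewrite !count_g; have := ltn_ord (f i); have := ltn_ord (f' i) => /=; lia.
- exact: opt.
- by [].
by exists (with_complements u (g f)), r; split=> //; move: Fr; rewrite card_ffun !card_ord.
Qed.

(** * Inputs made of thirds and two thirds *)

Lemma bin_load_const (R : realType) (x : R) p b :
  bin_load (nseq (size p) x) p b = (count_mem b p)%:R * x.
Proof.
elim: p => [|c p IH]; first by rewrite /bin_load big_nil mul0r.
by rewrite /= bin_load_cons IH natrD mulrDl; case: ifP => _; rewrite ?mul1r ?mul0r.
Qed.

(** Every load is at least the indicator of its bin being covered. When the two sums agree, nothing
    is wasted and each inequality is an equality. *)
Lemma perfect_covering_load (R : realType) (s : seq R) p b :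
  size p = size s -> (forall x, x \in s -> 0 <= x) ->
  (covered_bins s p)%:R = \sum_(x <- s) x -> b \in p ->
  bin_load s p b = (1 <= bin_load s p b)%R%:R.
Proof.
move=> sp s_ge0 cov bp.
have sum0 : \sum_(c <- undup p) (bin_load s p c - (1 <= bin_load s p c)%R%:R) == 0.
  rewrite sumrB (sum_bin_load_all sp) ?undup_uniq //; last first.
    by move=> c; rewrite mem_undup.
  by rewrite -cov /covered_bins -sum1_count natr_sum [X in X - _]big_mkcond /=
    subr_eq0; apply/eqP/eq_bigr => c _; case: ifP.
move: sum0; rewrite psumr_eq0 => [/allP/(_ b)|c _]; last first.
  by have := bin_load_ge0 p c s_ge0; case: (boolP (1 <= bin_load s p c)) => /=; lra.
by rewrite mem_undup bp => /(_ isT) /=; rewrite subr_eq0 => /eqP.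
Qed.

Lemma sum_count_mem_le (T : eqType) (D e : seq T) :
  uniq D -> (\sum_(b <- D) count_mem b e <= size e)%N.
Proof.
move=> uD; elim: e => [|x e IH]; first by rewrite big1.
rewrite /= big_split /= -add1n leq_add //.
have -> : (\sum_(b <- D) (x == b))%N = count_mem x D.
  rewrite -sum1_count [RHS]big_mkcond; apply: eq_bigr => b _ /=.
  by rewrite [b == x]eq_sym; case: (x == b).
by rewrite count_uniq_mem //; case: (_ \in _).
Qed.

Definition thirds (R : realType) (n j : nat) : seq R :=
  nseq (n - j) 3^-1 ++ nseq j (2 / 3).

Lemma thirds_gt0 (R : realType) n j x : x \in thirds R n j -> 0 < x.
Proof. by rewrite mem_cat => /orP[]/nseqP[-> _]; lra. Qed.

Lemma size_thirds (R : realType) n j : (j <= n)%N -> size (thirds R n j) = n.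
Proof. by move=> jn; rewrite size_cat !size_nseq subnK. Qed.

Lemma sum_thirds (R : realType) n j : (j <= n)%N ->
  \sum_(x <- thirds R n j) x = (n + j)%:R / 3.
Proof.
move=> jn; rewrite big_cat !big_nseq !iter_addr_0.
rewrite -[_ *+ (n - j)]mulr_natl -[_ *+ j]mulr_natl natrB // natrD /=; lra.
Qed.

(** The total size is [j + h]. It is reached by [j] bins holding one item of each size and [h] bins
    holding three items [1/3]. *)
Lemma OPT_thirds (R : realType) n j h : (n = 2 * j + 3 * h)%N ->
  OPT (thirds R n j) = (j + h)%N.
Proof.
move=> nE; have jn : (j <= n)%N by lia.
apply/eqP; rewrite eqn_leq; apply/andP; split.
  have [p sp <-] := OPT_exists (thirds R n j).
  have s_ge0 x : x \in thirds R n j -> 0 <= x by move/thirds_gt0/ltW.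
  rewrite -(ler_nat R); apply: le_trans (covered_bins_le_sum sp s_ge0) _.
  rewrite sum_thirds // (_ : n + j = 3 * (j + h))%N; last lia.
  by rewrite natrM; lra.
pose x : R := 3^-1.
pose G := nseq j [:: x] ++ nseq h [:: x; x; x].
have GE : flatten G = nseq (n - j) 3^-1.
  rewrite flatten_cat.
  have -> m : flatten (nseq m [:: x]) = nseq m x by elim: m => //= m ->.
  have -> m : flatten (nseq m [:: x; x; x]) = nseq (3 * m) x.
    by elim: m => // m IH; rewrite mulnS (nseqD 3) /= IH.
  by rewrite -nseqD; congr nseq; lia.
pose p := group_labels 0 G ++ iota 0 j.
have sl : size (group_labels 0 G) = size (nseq (n - j) (3^-1 : R)).
  by rewrite size_group_labels GE.
have sp : size p = size (thirds R n j).
  by rewrite !size_cat sl !size_nseq size_iota.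
apply: leq_trans (covered_bins_OPT sp).
rewrite -{1}(size_iota 0 (j + h)); apply: covered_bins_ge; first exact: iota_uniq.
move=> b; rewrite mem_iota add0n => /andP[_ bjh].
rewrite bin_load_cat // -GE -{1}[b]add0n bin_load_group_labels.
rewrite -{1}(size_iota 0 j) bin_load_const nth_cat size_nseq.
have [bj|jb] := ltnP b j.
  rewrite nth_nseq bj big_seq1 count_uniq_mem ?iota_uniq // mem_iota add0n bj /= /x; lra.
rewrite nth_nseq ifT ?ltn_subLR // !big_cons big_nil count_uniq_mem ?iota_uniq //.
by rewrite mem_iota add0n ltnNge jb /= /x; lra.
Qed.

(** The optimum equals the total size, so every load is 0 or 1; a bin in use has positive load,
    hence load 1, counted here in thirds. *)
Lemma thirds_perfect (R : realType) n j h p b : (n = 2 * j + 3 * h)%N ->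
  size p = size (thirds R n j) ->
  covered_bins (thirds R n j) p = OPT (thirds R n j) -> b \in p ->
  (count_mem b (take (n - j) p) + 2 * count_mem b (drop (n - j) p) = 3)%N.
Proof.
move=> nE sp cov bp; have jn : (j <= n)%N by lia.
have s_ge0 x : x \in thirds R n j -> 0 <= x by move/thirds_gt0/ltW.
have := @perfect_covering_load R _ p b sp s_ge0.
rewrite cov (OPT_thirds R nE) sum_thirds // => /(_ _ bp).
rewrite size_thirds // in sp.
have s1 : size (take (n - j) p) = (n - j)%N by rewrite size_takel // sp leq_subr.
have s2 : size (drop (n - j) p) = j by rewrite size_drop sp subKn.
have -> : bin_load (thirds R n j) p b = (count_mem b (take (n - j) p) +
    2 * count_mem b (drop (n - j) p))%:R / 3.
  rewrite -{1}(cat_take_drop (n - j) p) bin_load_cat ?size_nseq //.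
  rewrite -{1}s1 bin_load_const -{2}s2 bin_load_const natrD natrM; lra.
move: bp; rewrite -{1}(cat_take_drop (n - j) p) mem_cat -!has_pred1 !has_count.
set c1 := count _ _; set c2 := count _ _ => bp.
have sumE : (j + h)%:R = (n + j)%:R / 3 :> R.
  by rewrite (_ : n + j = 3 * (j + h))%N ?natrM; [lra | lia].
move=> /(_ sumE); case: (1 <= _) => /= e.
  by apply/eqP; rewrite -(eqr_nat R); apply/eqP; lra.
have /eqP : (c1 + 2 * c2)%:R = 0 :> R by lra.
by rewrite pnatr_eq0; move: bp; clear; lia.
Qed.

(* Going from [j] to [j' < j], each of the [j] bins with a single item [1/3] in
   the common prefix that gets no item [2/3] needs two more items [1/3]; there
   are at least [j - j'] such bins, but only [j - j'] more items [1/3]. *)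
Lemma thirds_conflict (R : realType) n j h j' h' p p' :
  (n = 2 * j + 3 * h)%N -> (n = 2 * j' + 3 * h')%N -> (j' < j)%N ->
  size p = size (thirds R n j) ->
  covered_bins (thirds R n j) p = OPT (thirds R n j) ->
  size p' = size (thirds R n j') ->
  covered_bins (thirds R n j') p' = OPT (thirds R n j') ->
  take (n - j) p <> take (n - j) p'.
Proof.
move=> nE nE' jj' sp cp sp' cp' e12.
have c3 b := thirds_perfect (b := b) nE sp cp.
have c3' b := thirds_perfect (b := b) nE' sp' cp'.
rewrite size_thirds in sp; last lia; rewrite size_thirds in sp'; last lia.
set p1 := take (n - j) p in c3; set p2 := drop (n - j) p in c3.
set p1' := take (n - j') p' in c3'; set p2' := drop (n - j') p' in c3'.
pose e := drop (n - j) p1'.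
have p1'E : p1' = p1 ++ e.
  by rewrite -[LHS](cat_take_drop (n - j)) /p1' take_takel; [rewrite -e12 | lia].
have se : size e = (j - j')%N by rewrite size_drop size_takel; lia.
have s2 : size p2 = j by rewrite size_drop sp; lia.
have s2' : size p2' = j' by rewrite size_drop sp'; lia.
have p2p b : b \in p2 -> b \in p by exact: mem_drop.
(* Two items [2/3] in one bin would already exceed three thirds. *)
have u2 : uniq p2.
  apply: count_mem_uniq => b; have [bp|] := boolP (b \in p2); last by move/count_memPn.
  have := c3 b (p2p b bp); move: bp; rewrite -has_pred1 has_count /=; lia.
pose D := [seq b <- p2 | b \notin p2'].
have sD : (j - j' <= size D)%N.
  have : (count (mem p2') p2 <= j')%N.
    rewrite -s2' -size_filter uniq_leq_size ?filter_uniq // => b.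
    by rewrite mem_filter => /andP[].
  have -> : size D = count (predC (mem p2')) p2 by rewrite size_filter; exact: eq_count.
  by have := count_predC (mem p2') p2; rewrite s2; lia.
have : (\sum_(b <- D) 2 <= \sum_(b <- D) count_mem b e)%N.
  rewrite big_seq [leqRHS]big_seq leq_sum // => b; rewrite mem_filter => /andP[b2' b2].
  have := c3 b (p2p b b2); rewrite (count_uniq_mem b u2) b2 => c1.
  have bp' : b \in p'.
    apply: (@mem_take (n - j)); rewrite -e12 -/p1 -has_pred1 has_count; lia.
  by have := c3' b bp'; rewrite p1'E count_cat (count_memPn b2'); lia.
have := @sum_count_mem_le _ D e (filter_uniq _ u2).
rewrite se big_const_seq count_predT iter_addn_0; lia.
Qed.

Lemma thirds_lower_bound (R : realType) (n : nat) (S : seq R) :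
  (6 <= n)%N -> 3^-1 \in S -> 2 / 3 \in S ->
  forall (A : online_alg R) (O : oracle R),
    optimal_on A O (fun s => size s = n /\ {subset s <= S}) ->
    exists (s : seq R) (r : nat),
      [/\ size s = n, {subset s <= S}, optimal_reading A O s r &
          (n %/ 6 <= 2 ^ r)%N].
Proof.
move=> n_ge6 S1 S2 A orc opt.
(* The residue of [J t] modulo 3 makes [n - 2 * J t] divisible by 3, and [t < n %/ 6] ensures
   [2 * J t <= n]. *)
pose J (t : 'I_(n %/ 6)) := ((2 * n) %% 3 + 3 * t)%N.
have nE t : {h | (n = 2 * J t + 3 * h)%N}.
  exists ((n - 2 * J t) %/ 3)%N; rewrite /J; have := ltn_ord t; lia.
have Jn t : (J t <= n)%N by have [h ->] := nE t; lia.
have S_in t : {subset thirds R n (J t) <= S}.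
  by move=> x; rewrite mem_cat => /orP[]/nseqP[-> _].
have /choice[r rP] t : exists r, optimal_reading A orc (thirds R n (J t)) r.
  by apply: opt; rewrite size_thirds.
have [|f g p q fg sp cp sq cq|t tr] := advice_lower_bound _ rP.
- by rewrite card_ord divn_gt0.
- have [[h fE] [h' gE]] := (nE f, nE g).
  have take_thirds j j' : (j' <= j)%N -> (j <= n)%N ->
      take (n - j) (thirds R n j') = nseq (n - j) 3^-1.
    move=> jj' jn; rewrite takel_cat ?size_nseq ?leq_sub2l // take_nseq //.
    by rewrite leq_sub2l.
  have fgJ : J f != J g.
    by apply: contra_neq fg => fgJ; apply/val_inj => /=; move: fgJ; rewrite /J; lia.
  have [lt|lt|eq] := ltngtP (J f) (J g); last by rewrite eq eqxx in fgJ.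
    exists (n - J g)%N; rewrite !size_thirds // !leq_subr; split=> //.
      by rewrite !take_thirds // ltnW.
    by move=> /esym; exact: thirds_conflict gE fE lt sq cq sp cp.
  exists (n - J f)%N; rewrite !size_thirds // !leq_subr; split=> //.
    by rewrite !take_thirds // ltnW.
  exact: thirds_conflict fE gE lt sp cp sq cq.
by exists (thirds R n (J t)), (r t); rewrite size_thirds //; split=> //; rewrite card_ord in tr.
Qed.

(** * Size sets of prescribed cardinality and the two regimes of [m] *)

Lemma size_set_extend (R : realType) (S0 : seq R) m :
  all (@item_size R) S0 -> (size S0 <= m)%N ->
  exists S, [/\ size_set S, size S = m & {subset S0 <= S}].
Proof.
move=> S0_size S0m; have s1 := leq_trans (size_undup S0) S0m.
have [S [[uS S_size] SE S0S]] : exists S, [/\ size_set S,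
    size S = (size (undup S0) + (m - size (undup S0)))%N & {subset S0 <= S}].
  elim: (m - _)%N => [|d [S [[uS S_size] SE S0S]]].
    exists (undup S0); rewrite addn0; split=> [|//|x]; last by rewrite mem_undup.
    split; first exact: undup_uniq.
    by apply/allP => x; rewrite mem_undup; move/allP: S0_size; apply.
  (* Among [size S + 1] distinct inverses of positive integers, one is not yet in [S]. *)
  pose invs := [seq (i.+1%:R : R)^-1 | i <- iota 0 (size S).+1].
  have /allPn[x /mapP[i _ ->] xS] : ~~ all (mem S) invs.
    apply/negP => /allP invsS; have : (size invs <= size S)%N.
      apply: uniq_leq_size => //; rewrite map_inj_uniq ?iota_uniq // => i j.
      by move/invr_inj/eqP; rewrite eqr_nat eqSS => /eqP.
    by rewrite size_map size_iota ltnn.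
  exists (i.+1%:R^-1 :: S); split=> [|/=|y /S0S yS]; last by rewrite inE yS orbT.
    split; rewrite /= ?xS // S_size andbT /item_size invr_gt0 ltr0n /=.
    by rewrite invf_le1 ?ltr0n // ler1n.
  by rewrite SE addnS.
by exists S; split=> //; rewrite SE subnKC.
Qed.

Lemma gadget_item_bound (R : realType) n l i : (i < l)%N -> (4 * l <= n)%N ->
  0 < gadget_item R n i < 2^-1.
Proof.
move=> il ln; rewrite divr_gt0 ?ltr0n ?addn1 //=.
by rewrite ltr_pdivrMr ?ltr0n // ltr_pdivlMl ?ltr0n // -natrM ltr_nat; nia.
Qed.

Lemma ln_nat_le (R : realType) (a b : nat) :
  (0 < a)%N -> (a <= b)%N -> ln a%:R <= ln b%:R :> R.
Proof.
move=> a_gt0 ab; have b_gt0 := leq_trans a_gt0 ab.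
by rewrite ler_ln ?posrE ?ltr0n // ler_nat.
Qed.

Lemma sizes_lower_bound_many (R : realType) (delta : R) (n m : nat) :
  0 < delta -> (4 <= m)%N -> m%:R <= n%:R `^ (1 - delta) ->
  2 * ln 2 <= delta * ln n%:R ->
  exists S : seq R, [/\ size_set S, size S = m &
    forall (A : online_alg R) (O : oracle R),
      optimal_on A O (fun s : seq R => size s = n /\ {subset s <= S}) ->
      exists (s : seq R) (r : nat),
        [/\ size s = n, {subset s <= S}, optimal_reading A O s r &
            delta / 12 * (m%:R * ln n%:R) <= r%:R]].
Proof.
move=> delta_gt0 m_ge4 m_le n_large.
have l2 := ln2_gt0 R.
have n_gt0 : (0 < n)%N.
  by have [n0|//] := posnP n; move: n_large; rewrite n0 (@ln0 R 0) // mulr0; lra.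
have ln_m : ln m%:R <= (1 - delta) * ln n%:R.
  rewrite -ln_powR ler_ln // posrE ?powR_gt0 ?ltr0n //; lia.
have lnM2 : ln (2 * m)%:R = ln 2 + ln m%:R :> R.
  by rewrite natrM lnM // posrE ltr0n //; lia.
(* The gadgets need [3 * l + 1] sizes, which must fit into [m]; [E] is the largest value with
   [4 * E * l <= n]. *)
pose l := ((m - 1) %/ 3)%N; pose E := (n %/ (4 * l))%N.
have l_gt0 : (0 < l)%N by rewrite /l; lia.
have ml : (m <= 6 * l)%N by rewrite /l; lia.
have lm : (4 * l <= 2 * m)%N by rewrite /l; lia.
have l4n : (4 * l <= n)%N.
  (* If [n < 2 * m], the bound on [m] would give [delta * ln n <= ln 2], against the assumption that
     [n] is large. *)
  apply: leq_trans lm _; rewrite leqNgt; apply/negP => nm.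
  have : ln n%:R <= ln (2 * m)%:R :> R by apply: ln_nat_le; rewrite // ltnW.
  rewrite lnM2 => h.
  lra.
have E_gt0 : (0 < E)%N by rewrite divn_gt0; lia.
have El : (4 * (E * l) <= n)%N by rewrite mulnCA; exact: leq_trunc_div.
(* From [n <= 2 * m * (E + 1)] and the bound on [m], [ln (E + 1) >= delta * ln n - ln 2], and [ln 2]
   is at most half of [delta * ln n]. *)
have lnE : delta / 2 * ln n%:R <= ln E.+1%:R.
  have : (n <= 2 * m * E.+1)%N.
    apply: (@leq_trans (4 * l * E.+1)); last by rewrite leq_mul2r lm orbT.
    by rewrite [X in (_ <= X)%N]mulnC ltnW // ltn_ceil // muln_gt0.
  move=> /(ln_nat_le R n_gt0); rewrite natrM lnM ?posrE ?ltr0n //; last lia.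
  by rewrite lnM2; lra.
pose x i := gadget_item R n i.
pose S0 := map x (iota 0 l) ++ map (fun i => 1 - x i) (iota 0 l) ++
  map (fun i => 1 - (x i + x i)) (iota 0 l) ++ [:: 1].
have [||S [S_set S_size S0S]] := @size_set_extend R S0 m.
- apply/allP => y; rewrite !mem_cat /item_size.
  by case/or4P => [|||/[!inE]/eqP->]; rewrite ?ltr01 ?lexx // => /mapP[i + ->];
    rewrite mem_iota add0n => /= /(@gadget_item_bound R n) -/(_ l4n); rewrite -/(x i); lra.
- by rewrite !size_cat !size_map size_iota /= /l; lia.
exists S; split=> // A orc opt.
have [||||s [r [sn sS sr Er]]] := gadgets_lower_bound E_gt0 El _ _ _ _ opt.
- by move=> i il; apply: S0S; rewrite !mem_cat map_f // mem_iota.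
- by move=> i il; apply: S0S; rewrite !mem_cat (map_f (fun i => 1 - x i)) ?orbT // mem_iota.
- by move=> i il; apply: S0S; rewrite !mem_cat (map_f (fun i => 1 - (x i + x i))) ?orbT // mem_iota.
- by apply: S0S; rewrite !mem_cat mem_head !orbT.
exists s, r; split=> //.
have M_gt0 : (0 < E.+1 ^ l)%N by rewrite expn_gt0.
apply: le_trans (ln_le_of_le_pow2 R M_gt0 Er).
rewrite natrX lnXn ?ltr0n // -[ln _ *+ _]mulr_natl.
apply: le_trans (_ : l%:R * (delta / 2 * ln n%:R) <= _); last by rewrite ler_wpM2l.
(* The constant combines [l >= m / 6] with the factor [delta / 2] from [lnE]. *)
have -> : delta / 12 * (m%:R * ln n%:R) = m%:R / 6 * (delta / 2 * ln n%:R) by lra.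
rewrite ler_wpM2r //; first lra.
by rewrite ler_pdivrMr // -natrM ler_nat mulnC.
Qed.

Lemma sizes_lower_bound_few (R : realType) (n m : nat) :
  (42 <= n)%N -> (2 <= m <= 3)%N ->
  exists S : seq R, [/\ size_set S, size S = m &
    forall (A : online_alg R) (O : oracle R),
      optimal_on A O (fun s : seq R => size s = n /\ {subset s <= S}) ->
      exists (s : seq R) (r : nat),
        [/\ size s = n, {subset s <= S}, optimal_reading A O s r &
            (6^-1 : R) * (m%:R * ln n%:R) <= r%:R]].
Proof.
move=> n_large /andP[m_ge2 m_le3].
have [|//|S [S_set S_size S0S]] := @size_set_extend R [:: 3^-1; 2 / 3] m.
  by rewrite /= /item_size; lra.
exists S; split=> // A orc opt.
have [|||s [r [sn sS sr Er]]] := thirds_lower_bound _ _ _ opt.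
- lia.
- by apply: S0S; rewrite inE eqxx.
- by apply: S0S; rewrite !inE eqxx orbT.
exists s, r; split=> //.
have q_gt0 : (0 < n %/ 6)%N by lia.
apply: le_trans (ln_le_of_le_pow2 R q_gt0 Er).
(* This holds from [n = 42] on and gives [ln (n %/ 6) >= ln n / 2]; the factor [1/6] then follows
   from [m <= 3]. *)
have : (n <= (n %/ 6) ^ 2)%N.
  by have := divn_eq n 6; have := ltn_mod n 6; rewrite expnS expn1; nia.
have n_gt0 : (0 < n)%N by lia.
move=> /(ln_nat_le R n_gt0); rewrite natrX lnXn ?ltr0n // -[ln _ *+ _]mulr_natl => hn.
have ln_ge0 : 0 <= ln n%:R :> R by rewrite ln_ge0 // ler1n; lia.
have m_le : m%:R <= 3 :> R by rewrite ler_nat.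
by have := ler_wpM2r ln_ge0 m_le; lra.
Qed.

(** * Assembling the bounds *)

Theorem theorem1 (R : realType) :
  (* (i), sufficiency: O(n log OPT) bits *)
  (exists (A : online_alg R) (O : oracle R) (C : R),
    forall s : seq R, all (@item_size R) s ->
      exists2 r : nat, optimal_reading A O s r &
        r%:R <= C * ((size s)%:R * ln (OPT s)%:R + 1))
  /\
  (* (i), necessity: Omega(n log OPT) bits *)
  (forall eps : R, 0 < eps ->
    exists2 c : R, 0 < c &
      forall n k : nat, (0 < k)%N -> 2 * k%:R <= (1 - eps) * n%:R ->
      forall (A : online_alg R) (O : oracle R),
        optimal_on A O (sparse_input eps n) ->
        exists (s : seq R) (r : nat),
          [/\ sparse_input eps n s, OPT s = k, optimal_reading A O s r &
              c * (n%:R * ln k%:R) <= r%:R])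
  /\
  (* (ii) *)
  (forall m : nat -> nat,
    (fun n : nat => (m n)%:R : R^o) =o_\oo (fun n : nat => n%:R : R^o) ->
    (* sufficiency: O(m log n) bits *)
    (exists (C : R) (N : nat),
      forall S : seq R, size_set S ->
      exists (A : online_alg R) (O : oracle R),
        forall s : seq R, {subset s <= S} ->
          exists2 r : nat, optimal_reading A O s r &
            (N <= size s)%N -> size S = m (size s) ->
            r%:R <= C * ((m (size s))%:R * ln (size s)%:R))
    /\
    (* necessity: Omega(m log n) bits. For m = 1 no advice is needed, and for m
       not bounded by a power n^(1 - delta) o(m log n) bits may suffice: O(log n)
       for n and log C(n + m - 1, n) for the multiset of the items. *)
    (forall delta : R, 0 < delta ->
      (\forall n \near \oo,
         (2 <= m n)%N /\ (m n)%:R <= n%:R `^ (1 - delta)) ->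
      exists2 c : R, 0 < c &
        \forall n \near \oo,
          exists S : seq R,
            [/\ size_set S, size S = m n &
              forall (A : online_alg R) (O : oracle R),
                optimal_on A O
                  (fun s : seq R => size s = n /\ {subset s <= S}) ->
                exists (s : seq R) (r : nat),
                  [/\ size s = n, {subset s <= S}, optimal_reading A O s r &
                      c * ((m n)%:R * ln n%:R) <= r%:R]])).
Proof.
split; first exact: optimal_advice_upper_bound.
split.
  move=> eps eps_gt0; exists eps => //; exact: optimal_advice_lower_bound.
move=> m _; split.
  exists (10 / ln 2), 2%N => S S_set.
  have [A [orc optA]] := sizes_upper_bound S_set; exists A, orc => s sS.
  have [r opt rle] := optA s sS; exists r => // n_ge2 S_size.
  apply: le_trans (_ : ((up_log 2 (size s).+1).+1 * (size S).+1).+1%:R <= _).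
    by rewrite ler_nat.
  rewrite -S_size number_advice_le //.
  case: s sS n_ge2 {S_size opt optA rle} => // x s sS _.
  by have := sS x (mem_head x s); case: (S).
move=> delta delta_gt0 m_bounds.
(* The regimes [m n >= 4] and [m n < 4] may alternate as [n] grows, so one constant has to serve
   both. *)
exists (Num.min (delta / 12) 6^-1); first by rewrite lt_min; apply/andP; split; lra.
near=> n.
have [m_ge2 m_le] : (2 <= m n)%N /\ (m n)%:R <= n%:R `^ (1 - delta) by near: n.
have n_ge42 : (42 <= n)%N by near: n; exact: nbhs_infty_ge.
have ln_n : 2 * ln 2 <= delta * ln n%:R.
  rewrite [delta * _]mulrC -ler_pdivrMr // -(expRK (_ / _)) ler_ln ?posrE ?expR_gt0 ?ltr0n //.
    by near: n; exact: nbhs_infty_ger.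
  by lia.
have mln_ge0 : 0 <= (m n)%:R * ln n%:R :> R.
  by rewrite mulr_ge0 // ln_ge0 // ler1n; lia.
have weaken (c : R) S : [/\ size_set S, size S = m n &
    forall (A : online_alg R) (O : oracle R),
      optimal_on A O (fun s : seq R => size s = n /\ {subset s <= S}) ->
      exists (s : seq R) (r : nat),
        [/\ size s = n, {subset s <= S}, optimal_reading A O s r &
            c * ((m n)%:R * ln n%:R) <= r%:R]] -> Num.min (delta / 12) 6^-1 <= c ->
    [/\ size_set S, size S = m n &
    forall (A : online_alg R) (O : oracle R),
      optimal_on A O (fun s : seq R => size s = n /\ {subset s <= S}) ->
      exists (s : seq R) (r : nat),
        [/\ size s = n, {subset s <= S}, optimal_reading A O s r &
            Num.min (delta / 12) 6^-1 * ((m n)%:R * ln n%:R) <= r%:R]].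
  case=> S_set S_size lb le_c; split=> // A orc /lb[s [r [sn sS sr cr]]].
  by exists s, r; split=> //; apply: le_trans cr; rewrite ler_wpM2r.
have [m_ge4|m_lt4] := leqP 4 (m n).
  have [S lb] := sizes_lower_bound_many delta_gt0 m_ge4 m_le ln_n.
  by exists S; apply: weaken lb _; rewrite ge_min lexx.
have [|S lb] := @sizes_lower_bound_few R n (m n) n_ge42; first by rewrite m_ge2.
by exists S; apply: weaken lb _; rewrite ge_min lexx orbT.
Unshelve. all: by end_near.
Qed.
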